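(* Let $(\mathfrak a,\{\cdot_\lambda\cdot\}_{\mathfrak a})$ be a Lie conformal algebra, $(\mathcal M;\varrho)$ a module over it, and let $\mathcal E=\mathfrak a\ltimes_\varrho\mathcal M$ be the semi-direct product, viewed as a quasi-twilled Lie conformal algebra $(\mathcal E,\mathfrak a,\mathcal M)$ (so $\{u_\lambda v\}_{\mathcal M}=0$, $\varrho_{\mathcal M}=0$, $\psi_1=0$). Then the curved $L_\infty$-algebra on $\bigoplus_{n\ge1}\mathscr C^n(\mathfrak a,\mathcal M)$ controlling right deformation maps $\mathfrak a\to\mathcal M$ (which are exactly the derivations from $\mathfrak a$ to $(\mathcal M;\varrho)$) is the cochain complex $\bigl(\bigoplus_{n\ge1}\mathscr C^n(\mathfrak a,\mathcal M),\mathbf d\bigr)$, where $\mathbf d$ is (up to the sign $(-1)^{k-1}$ on $\mathscr C^k$) the Chevalley-Eilenberg coboundary of $(\mathfrak a,\{\cdot_\lambda\cdot\}_{\mathfrak a})$ with values in $(\mathcal M;\varrho)$; that is, $l_0=0$, $l_k=0$ for $k\ge2$, and $l_1(f)=(-1)^{k-1}\mathbf d f$ for $f\in\mathscr C^k(\mathfrak a,\mathcal M)$, with $\mathbf d$ the Chevalley-Eilenberg coboundary.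
   Context: All vector spaces and linear maps are over $\mathbb C$, and all $\mathbb C[\partial]$-modules are finitely generated. A Lie conformal algebra is a $\mathbb C[\partial]$-module $\mathcal E$ with a $\mathbb C$-linear map $\mathcal E\otimes\mathcal E\to\mathcal E[\lambda]$, $x\otimes y\mapsto\{x_\lambda y\}$, such that $\{\partial x_\lambda y\}=-\lambda\{x_\lambda y\}$, $\{x_\lambda\partial y\}=(\partial+\lambda)\{x_\lambda y\}$, $\{x_\lambda y\}=-\{y_{-\lambda-\partial}x\}$ and $\{x_\lambda\{y_\mu z\}\}=\{\{x_\lambda y\}_{\lambda+\mu}z\}+\{y_\mu\{x_\lambda z\}\}$ ($\partial$ in a subscript acts from the left on the coefficients). A module $(\mathcal M;\varrho)$ is a $\mathbb C[\partial]$-module with a $\mathbb C$-linear $\varrho:\mathfrak a\to\mathrm{Cend}(\mathcal M)$ (maps $\varrho(a)_\lambda:\mathcal M\to\mathcal M[\lambda]$ with $\varrho(a)_\lambda(\partial m)=(\partial+\lambda)\varrho(a)_\lambda m$) such that $\varrho(\partial a)_\lambda=-\lambda\varrho(a)_\lambda$ and $\varrho(a)_\lambda\varrho(b)_\mu-\varrho(b)_\mu\varrho(a)_\lambda=\varrho(\{a_\lambda b\}_{\mathfrak a})_{\lambda+\mu}$. The semi-direct product $\mathfrak a\ltimes_\varrho\mathcal M$ is $\mathfrak a\oplus\mathcal M$ with $\{(a,m)_\lambda(b,n)\}=(\{a_\lambda b\}_{\mathfrak a},\varrho(a)_\lambda n-\varrho(b)_{-\lambda-\partial}m)$. A derivation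 from $\mathfrak a$ to $(\mathcal M;\varrho)$ is a $\mathbb C[\partial]$-module homomorphism $D$ with $D(\{a_\lambda b\}_{\mathfrak a})=\varrho(a)_\lambda D(b)-\varrho(b)_{-\lambda-\partial}D(a)$. A quasi-twilled Lie conformal algebra $(\mathcal E,\mathfrak a,\mathfrak b)$ is a Lie conformal algebra with a $\mathbb C[\partial]$-module decomposition $\mathcal E=\mathfrak a\oplus\mathfrak b$ such that $\mathfrak b$ is a subalgebra; a right deformation map is a $\mathbb C[\partial]$-module homomorphism $D:\mathfrak a\to\mathfrak b$ whose graph $\{(a,D(a))\}$ is a subalgebra of $\mathcal E$. Write $\{a_\lambda b\}_{\mathfrak a}=\mathrm{pr}_{\mathfrak a}\{a_\lambda b\}$, $\psi_{1,\lambda}(a,b)=\mathrm{pr}_{\mathfrak b}\{a_\lambda b\}$, $\varrho_{\mathfrak b}(u)_\lambda a=\mathrm{pr}_{\mathfrak a}\{u_\lambda a\}$, $\varrho_{\mathfrak a}(a)_\lambda v=\mathrm{pr}_{\mathfrak b}\{a_\lambda v\}$, $\{u_\lambda v\}_{\mathfrak b}=\{u_\lambda v\}$. Cochains: $\mathscr C^k(M,N)$, $k\ge1$, is the space of $\mathbb C$-linear maps $\varphi:M^{\otimes k}\to\mathbb C[\lambda_1,\dots,\lambda_{k-1}]\otimes N$ such that, with $\lambda_k^\ddagger:=-\sum_{j=1}^{k-1}\lambda_j-\partial$ ($\partial$ acting on $N$ from the left), (i) $\varphi(\dots,\partial a_i,\dots)=-\lambda_i\varphi(\dots,a_i,\dots)$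 for $1\le i\le k-1$ and $\varphi(\dots,\partial a_k)=-\lambda_k^\ddagger\varphi(\dots,a_k)$; (ii) for every permutation $\sigma$, $\varphi_{\lambda_1,\dots,\lambda_{k-1}}(a_1,\dots,a_k)=(-1)^\sigma\varphi_{\lambda_{\sigma(1)},\dots,\lambda_{\sigma(k-1)}}(a_{\sigma(1)},\dots,a_{\sigma(k)})|_{\lambda_k\mapsto\lambda_k^\ddagger}$. The Chevalley-Eilenberg coboundary is $$(\mathbf d f)_{\lambda_1,\dots,\lambda_k}(a_1,\dots,a_{k+1})=\Bigl(\sum_{i=1}^{k+1}(-1)^{i+1}\varrho(a_i)_{\lambda_i}f(a_1,\dots,\widehat{a_i},\dots,a_{k+1})+\sum_{i<j}(-1)^{i+j}f(\{a_{i\,\lambda_i}a_j\}_{\mathfrak a},a_1,\dots,\widehat{a_i},\dots,\widehat{a_j},\dots,a_{k+1})\Bigr)\Big|_{\lambda_{k+1}\mapsto\lambda_{k+1}^\ddagger},$$ where the subscripts of $f$ (suppressed) are the variables attached to all its arguments except the last, with $\lambda_i$ attached to $a_i$ and $\lambda_i+\lambda_j$ to $\{a_{i\,\lambda_i}a_j\}_{\mathfrak a}$. Nijenhuis-Richardson bracket: for $f\in\mathscr C^m(\mathcal E,\mathcal E)$, $g\in\mathscr C^n(\mathcal E,\mathcal E)$, $[f,g]_{NR}:=f\star g-(-1)^{(m-1)(n-1)}g\star f$, with $$(f\star g)_{\lambda_1,\dots,\lambda_{m+n-2}}(x_1,\dots,x_{m+n-1})=\sum_{\sigma}(-1)^\sigma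 f_{\lambda_{\sigma(1)}+\cdots+\lambda_{\sigma(n)},\lambda_{\sigma(n+1)},\dots,\lambda_{\sigma(m+n-2)}}\bigl(g_{\lambda_{\sigma(1)},\dots,\lambda_{\sigma(n-1)}}(x_{\sigma(1)},\dots,x_{\sigma(n)}),x_{\sigma(n+1)},\dots,x_{\sigma(m+n-1)}\bigr)\big|_{\lambda_{m+n-1}\mapsto\lambda_{m+n-1}^\ddagger}$$ over $(n,m-1)$-unshuffles. The curved $L_\infty$-algebra controlling right deformation maps is $\bigoplus_{n\ge0}\mathscr C^{n+1}(\mathfrak a,\mathfrak b)$ with $l_0=\widehat\psi$, $l_1(f)=[\widehat\nu_1,\widehat f\,]_{NR}$, $l_2(f,g)=[[\widehat\nu_2,\widehat f\,]_{NR},\widehat g\,]_{NR}$, $l_k=0$ for $k\ge3$, where $\widehat f((a_1,u_1),\dots,(a_k,u_k))=(0,f(a_1,\dots,a_k))$, $f$ is identified with $\widehat f$, and $\widehat\psi_\lambda((a,u),(b,v))=(0,\psi_{1,\lambda}(a,b))$, $\widehat\nu_{1,\lambda}((a,u),(b,v))=(\{a_\lambda b\}_{\mathfrak a},\varrho_{\mathfrak a}(a)_\lambda v-\varrho_{\mathfrak a}(b)_{-\lambda-\partial}u)$, $\widehat\nu_{2,\lambda}((a,u),(b,v))=(\varrho_{\mathfrak b}(u)_\lambda b-\varrho_{\mathfrak b}(v)_{-\lambda-\partial}a,\{u_\lambda v\}_{\mathfrak b})$. *)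

(* Defs.v *)
From HB Require Import structures.
From mathcomp Require Import all_boot all_order all_fingroup all_algebra.
From mathcomp Require Import finmap.
From mathcomp Require Export reals complex.
From mathcomp.multinomials Require Export monalg.

Set Implicit Arguments.
Unset Strict Implicit.
Unset Printing Implicit Defensive.

Import GRing.Theory.

Local Open Scope ring_scope.

(* A C[∂]-module is an lmodType over {poly K}, with ∂ acting as 'X and a     *)
(* scalar c : K acting as c%:P.                                              *)

Definition finitely_generated (A : nzRingType) (N : lmodType A) : Prop :=
  exists (n : nat) (g : 'I_n -> N),
    forall x, exists c : 'I_n -> A, x = \sum_i c i *: g i.

(* {mpoly {poly K}[n]} is K[∂][λ_0, ..., λ_(n-1)], a polynomial ring over    *)
(* which vpoly n N = K[λ_0, ..., λ_(n-1)] (x) N is a module: λ_i multiplies  *)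
(* monomials and ∂ acts on the coefficients, which lie in N.                 *)

Definition vpoly (K : fieldType) (n : nat) (N : lmodType {poly K}) :=
  {malg N['X_{1..n}]}.
Arguments vpoly {K} n N.

HB.instance Definition _ (K : fieldType) n (N : lmodType {poly K}) :=
  GRing.Zmodule.on (vpoly n N).

Section VpolyModule.
Variables (K : fieldType) (n : nat) (N : lmodType {poly K}).
Implicit Types (p q : {mpoly {poly K}[n]}) (u v : vpoly n N).

Definition vscale p u : vpoly n N :=
  \sum_(k <- msupp p) \sum_(l <- msupp u) << p@_k *: u@_l *g mmul k l >>.

Lemma vscalew (d1 d2 : {fset 'X_{1..n}}) p u :
  (msupp p `<=` d1)%fset -> (msupp u `<=` d2)%fset ->
  vscale p u =
    \sum_(k <- d1) \sum_(l <- d2) << p@_k *: u@_l *g mmul k l >>.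
Proof.
move=> le1 le2; rewrite /vscale (big_fset_incl _ le1) /=.
  apply/eq_bigr => k _; apply/big_fset_incl => // l _ /mcoeff_outdom ->.
  by rewrite scaler0 monalgU0.
move=> k _ /mcoeff_outdom pk.
by rewrite big1 // => l _; rewrite pk scale0r monalgU0.
Qed.

Lemma vscaleDr : right_distributive vscale +%R.
Proof.
move=> p u v.
rewrite [in RHS](vscalew (fsubset_refl _) (fsubsetUl _ (msupp v))).
rewrite [in RHS](vscalew (fsubset_refl _) (fsubsetUr (msupp u) _)).
rewrite (vscalew (fsubset_refl _) (msuppD_le u v)) -big_split /=.
apply/eq_bigr => k _; rewrite -big_split /=; apply/eq_bigr => l _.
by rewrite mcoeffD scalerDr monalgUD.
Qed.

Lemma vscaleDl u : {morph vscale^~ u : p q / p + q}.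
Proof.
move=> p q.
rewrite [in RHS](vscalew (fsubsetUl _ (msupp q)) (fsubset_refl _)).
rewrite [in RHS](vscalew (fsubsetUr (msupp p) _) (fsubset_refl _)).
rewrite (vscalew (msuppD_le p q) (fsubset_refl _)) -big_split /=.
apply/eq_bigr => k _; rewrite -big_split /=; apply/eq_bigr => l _.
by rewrite mcoeffD scalerDl monalgUD.
Qed.

Lemma vscale0l u : vscale 0 u = 0.
Proof. by rewrite /vscale msupp0 big_seq_fset0. Qed.

Lemma vscale0r p : vscale p 0 = 0.
Proof. by rewrite /vscale big1 // => k _; rewrite msupp0 big_seq_fset0. Qed.

Lemma vscaleUU c k (x : N) l :
  vscale << c *g k >> << x *g l >> = << c *: x *g mmul k l >>.
Proof. by rewrite (vscalew msuppU_le msuppU_le) !big_seq_fset1 !mcoeffUU. Qed.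

Lemma vscale_suml I (r : seq I) (F : I -> {mpoly {poly K}[n]}) u :
  vscale (\sum_(i <- r) F i) u = \sum_(i <- r) vscale (F i) u.
Proof. exact: (big_morph (vscale^~ u) (vscaleDl u) (vscale0l u)). Qed.

Lemma vscale_sumr I (r : seq I) (F : I -> vpoly n N) p :
  vscale p (\sum_(i <- r) F i) = \sum_(i <- r) vscale p (F i).
Proof. exact: (big_morph (vscale p) (vscaleDr p) (vscale0r p)). Qed.

Lemma vpolyE u : u = \sum_(l <- msupp u) (<< u@_l *g l >> : vpoly n N).
Proof. exact: monalgE. Qed.

Lemma vscaleA p q u : vscale p (vscale q u) = vscale (p * q) u.
Proof.
rewrite [u]vpolyE vscale_sumr vscale_sumr vscale_sumr; apply: eq_bigr => l _.
rewrite [q]monalgE mulr_sumr !vscale_suml vscale_sumr; apply: eq_bigr => k _.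
rewrite [p]monalgE mulr_suml !vscale_suml; apply: eq_bigr => j _.
have -> : << p@_j *g j >> * << q@_k *g k >>
    = << p@_j * q@_k *g mmul j k >> :> {mpoly {poly K}[n]}.
  exact: fgmulUU.
have := vscaleUU p@_j j (q@_k *: u@_l) (mmul k l).
rewrite scalerA mulmA => E.
apply: etrans (congr1 (vscale << p@_j *g j >>) (vscaleUU q@_k k u@_l l)) _.
exact: etrans E (esym (vscaleUU (p@_j * q@_k) (mmul j k) u@_l l)).
Qed.

Lemma vscale1 : left_id 1 vscale.
Proof.
move=> u; rewrite [u]vpolyE vscale_sumr; apply: eq_bigr => l _.
by rewrite (vscaleUU 1) scale1r mul1m.
Qed.

HB.instance Definition _ :=
  GRing.Zmodule_isLmodule.Build {mpoly {poly K}[n]} (vpoly n N)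
    vscaleA vscale1 vscaleDr vscaleDl.

End VpolyModule.

Section Operations.
Variable K : fieldType.

Definition var n (i : 'I_n) : {mpoly {poly K}[n]} := << ucm i >>.
Definition dpar n : {mpoly {poly K}[n]} := ('X : {poly K})%:MP.

(* The constant c%:P%:MP is c : K; this is K-linearity.                      *)
Definition klinear n (M N : lmodType {poly K}) (h : M -> vpoly n N) : Prop :=
  forall (c : K) x y, h (c%:P *: x + y) = (c%:P)%:MP *: h x + h y.

(* Substitution λ_i := p i; a ∂ occurring in p i acts on the coefficients.   *)
Definition subst m n (N : lmodType {poly K}) (p : 'I_m -> {mpoly {poly K}[n]})
    (u : vpoly m N) : vpoly n N :=
  \sum_(k <- msupp u) (\prod_i p i ^+ k i) *: ((u@_k)%:MP : vpoly n N).

(* h applied to the coefficients of u, the two families of variables being   *)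
(* identified: (λ^k x) |-> λ^k h(x).                                         *)
Definition ext n (M N : lmodType {poly K}) (h : M -> vpoly n N)
    (u : vpoly n M) : vpoly n N :=
  \sum_(k <- msupp u) << k >> *: h u@_k.

Definition coefmap n (M N : lmodType {poly K}) (h : M -> N)
    (u : vpoly n M) : vpoly n N :=
  \sum_(k <- msupp u) << h u@_k *g k >>.

Definition vpair n (M N : lmodType {poly K}) (u : vpoly n M) (v : vpoly n N)
    : vpoly n (M * N)%type :=
  coefmap (fun x => (x, 0)) u + coefmap (fun y => (0, y)) v.

(* In K[λ_0, ..., λ_n] the last variable is replaced by                      *)
(* - (λ_0 + ... + λ_(n-1)) - ∂, the others being kept.                       *)
Definition dagger n (i : 'I_n.+1) : {mpoly {poly K}[n]} :=
  if unlift ord_max i is Some j then var j else - \sum_j var j - dpar n.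

Definition dag n (N : lmodType {poly K}) (u : vpoly n.+1 N) : vpoly n N :=
  subst (@dagger n) u.

End Operations.

Arguments var {K n}.
Arguments dpar {K n}.
Arguments dagger {K n}.

Section LieConformal.
Variable K : fieldType.

(* br x y = {x_λ y}, with λ = var 0 in vpoly 1 E. *)
Record is_lca (E : lmodType {poly K}) (br : E -> E -> vpoly 1 E) : Prop := {
  lca_fg : finitely_generated E;
  lca_linl : forall y, klinear (br^~ y);
  lca_linr : forall x, klinear (br x);
  lca_dl : forall x y, br ('X *: x) y = - var 0 *: br x y;
  lca_dr : forall x y, br x ('X *: y) = (dpar + var 0) *: br x y;
  lca_skew : forall x y,
    br x y = - subst (fun=> - var 0 - dpar) (br y x);
  lca_jacobi : forall x y z,
    let lam : {mpoly {poly K}[2]} := var 0 in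
    let mu : {mpoly {poly K}[2]} := var 1 in
    ext (fun w => subst (fun=> lam) (br x w)) (subst (fun=> mu) (br y z)) =
      ext (fun w => subst (fun=> lam + mu) (br w z))
          (subst (fun=> lam) (br x y)) +
      ext (fun w => subst (fun=> mu) (br y w)) (subst (fun=> lam) (br x z))
}.

Record is_lca_module (E M : lmodType {poly K}) (br : E -> E -> vpoly 1 E)
    (rho : E -> M -> vpoly 1 M) : Prop := {
  lcm_fg : finitely_generated M;
  lcm_linl : forall m, klinear (rho^~ m);
  lcm_linr : forall x, klinear (rho x);
  lcm_dr : forall x m, rho x ('X *: m) = (dpar + var 0) *: rho x m;
  lcm_dl : forall x m, rho ('X *: x) m = - var 0 *: rho x m;
  lcm_comm : forall x y m,
    let lam : {mpoly {poly K}[2]} := var 0 in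
    let mu : {mpoly {poly K}[2]} := var 1 in
    ext (fun w => subst (fun=> lam) (rho x w)) (subst (fun=> mu) (rho y m)) -
    ext (fun w => subst (fun=> mu) (rho y w)) (subst (fun=> lam) (rho x m)) =
      ext (fun w => subst (fun=> lam + mu) (rho w m))
          (subst (fun=> lam) (br x y))
}.

Definition semidirect (a M : lmodType {poly K}) (br : a -> a -> vpoly 1 a)
    (rho : a -> M -> vpoly 1 M) (x y : a * M) : vpoly 1 (a * M)%type :=
  vpair (br x.1 y.1)
    (rho x.1 y.2 - subst (fun=> - var 0 - dpar) (rho y.1 x.2)).

Definition is_derivation (a M : lmodType {poly K}) (br : a -> a -> vpoly 1 a)
    (rho : a -> M -> vpoly 1 M) (D : {linear a -> M}) : Prop :=
  forall x y, coefmap D (br x y) =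
    rho x (D y) - subst (fun=> - var 0 - dpar) (rho y (D x)).

Definition lca_subalgebra (E : lmodType {poly K}) (br : E -> E -> vpoly 1 E)
    (S : {pred E}) : Prop :=
  submod_closed S /\
  forall x y, x \in S -> y \in S -> forall k, (br x y)@_k \in S.

(* The decomposition E = a (+) b is E = a * b. *)
Definition quasi_twilled (a b : lmodType {poly K})
    (brE : (a * b)%type -> (a * b)%type -> vpoly 1 (a * b)%type) : Prop :=
  is_lca brE /\ lca_subalgebra brE [pred x | x.1 == 0].

Definition right_deformation_map (a b : lmodType {poly K})
    (brE : (a * b)%type -> (a * b)%type -> vpoly 1 (a * b)%type)
    (D : {linear a -> b}) : Prop :=
  lca_subalgebra brE [pred x | x.2 == D x.1].

Section Components.
Variables a b : lmodType {poly K}.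
Variable brE : (a * b)%type -> (a * b)%type -> vpoly 1 (a * b)%type.

Definition br_a (x y : a) : vpoly 1 a := coefmap fst (brE (x, 0) (y, 0)).
Definition psi1 (x y : a) : vpoly 1 b := coefmap snd (brE (x, 0) (y, 0)).
Definition rho_b (u : b) (x : a) : vpoly 1 a :=
  coefmap fst (brE (0, u) (x, 0)).
Definition rho_a (x : a) (v : b) : vpoly 1 b :=
  coefmap snd (brE (x, 0) (0, v)).
Definition br_b (u v : b) : vpoly 1 b := coefmap snd (brE (0, u) (0, v)).

End Components.
End LieConformal.

Section Cochains.
Variable K : fieldType.

(* Maps of n.+1 arguments with values in polynomials in n variables. *)
Definition kmap n (M N : lmodType {poly K}) :=
  {ffun 'I_n.+1 -> M} -> vpoly n N.

(* f with variable w i attached to the argument x i, for every i but the     *)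
(* last.                                                                     *)
Definition fapp n q (M N : lmodType {poly K}) (f : kmap n M N)
    (w : 'I_n.+1 -> {mpoly {poly K}[q]}) (x : {ffun 'I_n.+1 -> M})
    : vpoly q N :=
  subst (fun i : 'I_n => w (widen_ord (leqnSn n) i)) (f x).

Definition fset_at n (M : Type) (x : {ffun 'I_n -> M}) (i : 'I_n) (v : M)
    : {ffun 'I_n -> M} :=
  [ffun j => if j == i then v else x j].

(* The space C^(n+1)(M, N). *)
Record is_cochain n (M N : lmodType {poly K}) (f : kmap n M N) : Prop := {
  cochain_lin : forall x i, klinear (fun v => f (fset_at x i v));
  cochain_d : forall x i, f (fset_at x i ('X *: x i)) = - dagger i *: f x;
  cochain_skew : forall (s : 'S_n.+1) x,
    f x = (-1) ^+ odd_perm s *: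
            dag (fapp f (fun i => var (s i)) [ffun i => x (s i)])
}.

Record cochain n (M N : lmodType {poly K}) := Cochain {
  cochain_map :> kmap n M N;
  cochainP : is_cochain cochain_map
}.

(* The finite sequence (w, y 0, y 1, ...). *)
Definition fcons (T : Type) n (w : T) (y : nat -> T) (t : 'I_n) : T :=
  if val t is t'.+1 then y t' else w.

(* (df)(x_0, ..., x_(n+1)), computed in the variables λ_0, ..., λ_(n+1).     *)
(* For i < j, bump j (bump i t) is the t-th index distinct from i and j.     *)
Definition ce_d n (a M : lmodType {poly K}) (br : a -> a -> vpoly 1 a)
    (rho : a -> M -> vpoly 1 M) (f : kmap n a M) : kmap n.+1 a M :=
  fun x => dag (
    \sum_(i < n.+2) (-1) ^+ i *:
      ext (fun m => subst (fun=> var i) (rho (x i) m))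
          (fapp f (fun t => var (lift i t)) [ffun t => x (lift i t)])
  + \sum_(i < n.+2) \sum_(j < n.+2 | (i < j)%N) (-1) ^+ (i + j) *:
      let skip t : 'I_n.+2 := inord (bump j (bump i t)) in
      ext (fun c => fapp f (fcons (var i + var j) (fun t => var (skip t)))
                           [ffun t => fcons c (fun t' => x (skip t')) t])
          (subst (fun=> var i) (br (x i) (x j)))).

Definition unshuffle (q p : nat) (s : 'S_p) : bool :=
  [forall i : 'I_p, forall j : 'I_p,
     ((i < j) && ((j < q) || (q <= i)) ==> (s i < s j))%N].

(* f * g for f of m.+1 and g of n.+1 arguments, to be used with p = m + n    *)
(* only; p is free so that both f * g and g * f have p.+1 arguments without  *)
(* casts.                                                                    *)
Definition star m n p (E : lmodType {poly K}) (f : kmap m E E)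
    (g : kmap n E E) : kmap p E E :=
  fun x => \sum_(s : 'S_p.+1 | unshuffle n.+1 s) (-1) ^+ odd_perm s *:
    let sg k : 'I_p.+1 := s (inord k) in
    dag (ext (fun c => fapp f
            (fcons (\sum_(j < n.+1) var (sg j)) (fun t => var (sg (n.+1 + t))))
            [ffun t => fcons c (fun t' => x (sg (n.+1 + t'))) t])
         (fapp g (fun j => var (sg j)) [ffun j : 'I_n.+1 => x (sg j)])).

Definition nr_bracket m n (E : lmodType {poly K}) (f : kmap m E E)
    (g : kmap n E E) : kmap (m + n) E E :=
  fun x => star (p := m + n) f g x - (-1) ^+ (m * n) *: star (p := m + n) g f x.

Definition hat n (a b : lmodType {poly K}) (f : kmap n a b)
    : kmap n (a * b)%type (a * b)%type :=
  fun x => vpair 0 (f [ffun i => (x i).1]).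

Section Linfty.
Variables a b : lmodType {poly K}.
Variable brE : (a * b)%type -> (a * b)%type -> vpoly 1 (a * b)%type.
Let E : lmodType {poly K} := (a * b)%type.

Definition psi_hat : kmap 1 E E :=
  fun x => vpair 0 (psi1 brE (x 0).1 (x 1).1).

Definition nu1_hat : kmap 1 E E :=
  fun x => let: (y, u) := x 0 in let: (z, v) := x 1 in
    vpair (br_a brE y z)
      (rho_a brE y v - subst (fun=> - var 0 - dpar) (rho_a brE z u)).

Definition nu2_hat : kmap 1 E E :=
  fun x => let: (y, u) := x 0 in let: (z, v) := x 1 in
    vpair (rho_b brE u z - subst (fun=> - var 0 - dpar) (rho_b brE v y))
      (br_b brE u v).

(* linf [:: f_1; ...; f_k] = l_k(f_1, ..., f_k) on homogeneous elements,     *)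
(* given with their index n, f in C^(n+1)(a, b). The values are seen in      *)
(* C(E, E) through hat.                                                      *)
Definition linf (fs : seq {n : nat & cochain n a b}) : {n : nat & kmap n E E} :=
  let mk n (F : kmap n E E) : {n : nat & kmap n E E} :=
    Tagged (fun n => kmap n E E) F in
  match fs with
  | [::] => mk _ psi_hat
  | [:: f] => mk _ (nr_bracket nu1_hat (hat (tagged f)))
  | [:: f; g] =>
      mk _ (nr_bracket (nr_bracket nu2_hat (hat (tagged f))) (hat (tagged g)))
  | _ => mk (sumn [seq tag f | f <- fs]).+1 (fun=> 0)
  end.

End Linfty.
End Cochains.

(* Main.v *)
Require Import Defs.
From HB Require Import structures.
From mathcomp Require Import all_boot all_order all_fingroup all_algebra.
From mathcomp Require Import finmap ring zify.
From mathcomp Require Import reals complex.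

Set Implicit Arguments.
Unset Strict Implicit.
Unset Printing Implicit Defensive.

Import GRing.Theory.
Local Open Scope ring_scope.

(** In the semi-direct product, M is an abelian ideal: psi_1, the action of M
    on a and the bracket of M all vanish.  Hence l_0 = 0, and l_2 = 0 because
    nu_2 = 0; only l_1 = [nu_1, -] is left.  The graph of D is stable under
    the bracket iff every coefficient of {(x, D x)_lambda (y, D y)} lies in
    it, which is the derivation identity read coefficient by coefficient
    ([right_deformation_derivation]).

    That l_1 is the differential up to sign is a matching of sums.  The
    unshuffles in nu_1 * f are determined by the index i that they put last,
    those in f * nu_1 by the pair i < j that they put first
    ([sum_unshuffle_last], [sum_unshuffle_pair]).  The former give the terms
    rho(x_i) f(...), the latter the terms f({x_i x_j}, ...).  In the former
    x_i is the second argument of nu_1, so skew-symmetry makes it act with the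
    variable - mu - ∂, where mu is the sum of the other variables;
    since all the variables add up to - ∂ once the last one
    has been eliminated, this is lambda_i again ([star_nu1_hat_term]).

    The remaining claims are that the semi-direct product is a Lie conformal
    algebra, that d f is a cochain, and that d d f = 0.  All of them are
    identities between polynomials in the lambda_i with coefficients in a
    module, and such polynomials are determined by their values at scalar
    points ([ev_inj]).  At a scalar point the lambda-operations become a
    graded Lie algebra with a representation: give the argument x the variable
    value p, its momentum, and let momenta add up under the bracket.  The
    argument whose variable is eliminated has the value - (sum of the others)
    - ∂ instead of a scalar.  To treat all the arguments alike, a momentum is
    a pair (p, k) where k counts the eliminated arguments that went into an
    element.  The axioms of a Lie algebra and of a representation then hold at
    a momentum (p, 0) modulo the image of ∂ + p, at (p, 1) exactly, and
    nothing is asked at (p, k) with k >= 2 ([negligible],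
    [homogeneous_graded_lie]).

    A cochain becomes an alternating multilinear function of lists of
    homogeneous elements ([kmap_at], [kmap_at_respects],
    [kmap_at_alternating]), and the differential is the one of Cartan's
    calculus, determined by i_x d = L_x - d i_x.  By induction on the
    number of arguments d commutes with L_x and d d = 0 ([cartanD_lieD],
    [cartanD_cartanD]), and d preserves alternation and multilinearity.
    Unfolding the recursion gives the two sums of Chevalley and Eilenberg
    ([ce_sumE]), and these are the values of the differential of a cochain
    ([kmap_at_ce_d]).  At lists of total momentum (p, 1) all congruences are
    equalities, which carries the result back to cochains. *)

(** * Additive maps and evaluation *)

Section ZmodMorphisms.
Variables (U W : zmodType) (f : U -> W).
Hypothesis fB : zmod_morphism f.

Lemma zmorph0 : f 0 = 0.
Proof. by rewrite -[in LHS](subrr 0) fB subrr. Qed.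

Lemma zmorphN x : f (- x) = - f x.
Proof. by rewrite -[in LHS](add0r (- x)) fB zmorph0 add0r. Qed.

Lemma zmorphD x y : f (x + y) = f x + f y.
Proof. by rewrite -[in LHS](opprK y) fB zmorphN opprK. Qed.

Lemma zmorph_sum I r (P : pred I) F :
  f (\sum_(i <- r | P i) F i) = \sum_(i <- r | P i) f (F i).
Proof. exact: (big_morph f zmorphD zmorph0). Qed.

End ZmodMorphisms.

Lemma morphD_zmod (U W : zmodType) (f : U -> W) :
  {morph f : x y / x + y} -> zmod_morphism f.
Proof.
move=> fD x y; apply: (addIr (f y)).
by rewrite -fD !subrK.
Qed.

Section Generators.
Variables (I : choiceType) (N W : zmodType).

Lemma malg_ext (f g : {malg N[I]} -> W) :
    zmod_morphism f -> zmod_morphism g ->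
  (forall x k, f << x *g k >> = g << x *g k >>) -> f =1 g.
Proof.
move=> fB gB fg u; rewrite [u]monalgE (zmorph_sum fB) (zmorph_sum gB).
exact: eq_bigr.
Qed.

Variable h : I -> N -> W.
Hypothesis hB : forall k, zmod_morphism (h k).

Lemma malg_sumE (d : {fset I}) (u : {malg N[I]}) : (msupp u `<=` d)%fset ->
  \sum_(k <- msupp u) h k u@_k = \sum_(k <- d) h k u@_k.
Proof.
move=> le; apply: big_fset_incl => // k _ /mcoeff_outdom ->.
exact: zmorph0.
Qed.

Lemma malg_sumB :
  zmod_morphism (fun u : {malg N[I]} => \sum_(k <- msupp u) h k u@_k).
Proof.
apply: morphD_zmod => u v.
rewrite (malg_sumE (msuppD_le u v)) (malg_sumE (fsubsetUl _ (msupp v))).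
rewrite (malg_sumE (fsubsetUr (msupp u) _)) -big_split /=.
by apply: eq_bigr => k _; rewrite mcoeffD zmorphD.
Qed.

Lemma malg_sumU x k :
  \sum_(l <- msupp (<< x *g k >> : {malg N[I]})) h l (<< x *g k >>)@_l = h k x.
Proof. by rewrite (malg_sumE msuppU_le) big_seq_fset1 mcoeffUU. Qed.

End Generators.

(** The value at w of the monomial k; a monoid morphism, so that evaluation of
    polynomials at w is a ring morphism. *)
Definition powers (S : comRingType) n (w : 'I_n -> S) (k : 'X_{1..n}) : S :=
  \prod_i w i ^+ k i.

Lemma powers_mmorphism (S : comRingType) n (w : 'I_n -> S) :
  mmorphism (powers w).
Proof.
split=> [k l|]; last by rewrite /powers big1 // => i _; rewrite cm1.
by rewrite /powers -big_split /=; apply: eq_bigr => i _; rewrite cmM exprD.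
Qed.

HB.instance Definition _ (S : comRingType) n (w : 'I_n -> S) :=
  monalg.isMultiplicative.Build _ S (powers w) (powers_mmorphism w).

Lemma scalerMCA (S : comRingType) (V : lmodType S) (a b c : S) (v : V) :
  (a * b) *: (c *: v) = (c * a) *: (b *: v).
Proof. by rewrite !scalerA [_ * c]mulrC mulrA. Qed.

Section Substitution.
Variable K : fieldType.
Local Notation P n := {mpoly {poly K}[n]}.

(** The scalar counterpart of [ev]: by [evZ] evaluation of vectors is
    semilinear along [peval]. *)
Definition peval n (w : 'I_n -> {poly K}) (c : P n) : {poly K} :=
  mmap idfun (powers w) c.

Fact peval_zmod n (w : 'I_n -> {poly K}) : zmod_morphism (peval w).
Proof. exact: raddfB. Qed.
Fact peval_monoid n (w : 'I_n -> {poly K}) : monoid_morphism (peval w).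
Proof. by split; [exact: rmorph1|exact: rmorphM]. Qed.
HB.instance Definition _ n (w : 'I_n -> {poly K}) :=
  GRing.isZmodMorphism.Build (P n) {poly K} (peval w) (peval_zmod w).
HB.instance Definition _ n (w : 'I_n -> {poly K}) :=
  GRing.isMonoidMorphism.Build (P n) {poly K} (peval w) (peval_monoid w).

Lemma pevalD n (w : 'I_n -> {poly K}) c d :
  peval w (c + d) = peval w c + peval w d.
Proof. exact: raddfD. Qed.

Lemma pevalN n (w : 'I_n -> {poly K}) c : peval w (- c) = - peval w c.
Proof. exact: raddfN. Qed.

Lemma peval_sum n (w : 'I_n -> {poly K}) I (r : seq I) Q (F : I -> P n) :
  peval w (\sum_(i <- r | Q i) F i) = \sum_(i <- r | Q i) peval w (F i).
Proof. exact: raddf_sum. Qed.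

(** The substitution lambda_i := w i, where the values are polynomials in the
    derivation and act on the module.  Taking them in C[∂] and not in C leaves
    room for the value of an eliminated variable. *)
Definition ev n (N : lmodType {poly K}) (w : 'I_n -> {poly K})
    (u : vpoly n N) : N :=
  \sum_(k <- msupp u) powers w k *: u@_k.

Lemma powersU (S : comRingType) n (w : 'I_n -> S) i : powers w (ucm i) = w i.
Proof.
rewrite /powers (bigD1 i) //= cmUU big1 ?mulr1 // => j /negPf ij.
by rewrite cmU eq_sym ij.
Qed.

Lemma pevalU n (w : 'I_n -> {poly K}) c k : peval w << c *g k >> = c * powers w k.
Proof. exact: mmapU. Qed.

Lemma peval_var n (w : 'I_n -> {poly K}) i : peval w (var i) = w i.
Proof. by rewrite pevalU powersU mul1r. Qed.

Lemma peval_malgC n (w : 'I_n -> {poly K}) c : peval w c%:MP = c.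
Proof. by rewrite pevalU mmorph1 mulr1. Qed.

Lemma peval_dpar n (w : 'I_n -> {poly K}) : peval w dpar = 'X.
Proof. exact: peval_malgC. Qed.

Lemma peval_dparDvar n (w : 'I_n -> {poly K}) i :
  peval w (dpar + var i) = 'X + w i.
Proof.
exact (etrans (pevalD _ _ _) (congr2 +%R (peval_dpar w) (peval_var w i))).
Qed.

Lemma peval_varDvar n (w : 'I_n -> {poly K}) i j :
  peval w (var i + var j) = w i + w j.
Proof.
exact (etrans (pevalD _ _ _) (congr2 +%R (peval_var w i) (peval_var w j))).
Qed.

Lemma peval_Nvar n (w : 'I_n -> {poly K}) i : peval w (- var i) = - w i.
Proof. exact (etrans (pevalN _ _) (congr1 -%R (peval_var w i))). Qed.

Lemma peval_NvarBdpar n (w : 'I_n -> {poly K}) i :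
  peval w (- var i - dpar) = - w i - 'X.
Proof.
apply: etrans (pevalD _ _ _) (congr2 +%R (peval_Nvar w i) _).
exact (etrans (pevalN _ _) (congr1 -%R (peval_dpar w))).
Qed.

Lemma powers_peval m n (w : 'I_n -> {poly K}) (q : 'I_m -> P n) k :
  peval w (powers q k) = powers (fun i => peval w (q i)) k.
Proof.
rewrite /powers (rmorph_prod (peval w)); apply: eq_bigr => i _ /=.
by rewrite rmorphXn.
Qed.

Lemma eq_powers (S : comRingType) n (w w' : 'I_n -> S) k :
  w =1 w' -> powers w k = powers w' k.
Proof. by move=> ww; apply: eq_bigr => i _; rewrite ww. Qed.

Section Vectors.
Variables (n : nat) (N : lmodType {poly K}).
Implicit Types (u v : vpoly n N).

Lemma vscaleU c k (x : N) l :
  (<< c *g k >> : P n) *: (<< x *g l >> : vpoly n N) = << c *: x *g mmul k l >>.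
Proof. exact: vscaleUU. Qed.

Lemma vpolyUE (x : N) l :
  << x *g l >> = (<< l >> : P n) *: (x%:MP : vpoly n N).
Proof. by rewrite vscaleU scale1r mulm1. Qed.

Lemma ev_zmod w : zmod_morphism (@ev n N w).
Proof.
by apply: (malg_sumB (h := fun k x => powers w k *: x)) => k x y;
  rewrite scalerBr.
Qed.
HB.instance Definition _ w :=
  GRing.isZmodMorphism.Build (vpoly n N) N (ev w) (ev_zmod w).

Lemma evU w x k : ev w (<< x *g k >> : vpoly n N) = powers w k *: x.
Proof.
by rewrite /ev (malg_sumU (h := fun k x => powers w k *: x)) // => l y z;
   rewrite scalerBr.
Qed.

Lemma evC w (x : N) : ev w (x%:MP : vpoly n N) = x.
Proof. by rewrite evU mmorph1 scale1r. Qed.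

Lemma evZ w (c : P n) u : ev w (c *: u) = peval w c *: ev w u.
Proof.
apply: (malg_ext (f := fun u : vpoly n N => ev w (c *: u))
                 (g := fun u => peval w c *: ev w u)) u.
- by move=> u v; rewrite scalerBr raddfB.
- by move=> u v; rewrite raddfB scalerBr.
move=> x k; pose X : vpoly n N := << x *g k >>.
apply: (malg_ext (f := fun c : P n => ev w (c *: X))
                 (g := fun c => peval w c *: ev w X)) c.
- by move=> c d; rewrite scalerBl raddfB.
- by move=> c d; rewrite raddfB scalerBl.
move=> c l; rewrite /X (vscaleU c l x k) [LHS]evU [in RHS]evU pevalU mmorphM.
refine (scalerMCA _ _ _ _).
Qed.

Lemma eq_ev w w' u : w =1 w' -> ev w u = ev w' u.
Proof. by move=> ww; apply: eq_bigr => k _; rewrite (eq_powers _ ww). Qed.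

End Vectors.

Section SubstVectors.
Variables (n m : nat) (N : lmodType {poly K}).
Implicit Types (u v : vpoly n N) (q : 'I_n -> P m).

Lemma subst_zmod q : zmod_morphism (@subst K n m N q).
Proof.
apply: (malg_sumB (h := fun k x => powers q k *: (x%:MP : vpoly m N))) => k x y.
by rewrite monalgUB scalerBr.
Qed.
HB.instance Definition _ q :=
  GRing.isZmodMorphism.Build (vpoly n N) (vpoly m N) (subst q) (subst_zmod q).

Lemma substU q x k :
  subst q (<< x *g k >> : vpoly n N) = powers q k *: (x%:MP : vpoly m N).
Proof.
rewrite /subst (malg_sumU (h := fun k x => powers q k *: (x%:MP : vpoly m N)))//.
by move=> l y z; rewrite monalgUB scalerBr.
Qed.

Lemma eq_subst q q' u : q =1 q' -> subst q u = subst q' u.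
Proof.
move=> ww; apply: eq_bigr => k _.
exact (congr1 (fun z => z *: _) (eq_powers k ww)).
Qed.

End SubstVectors.

Lemma ev_subst m n (N : lmodType {poly K}) (w : 'I_n -> {poly K})
    (q : 'I_m -> P n) (u : vpoly m N) :
  ev w (subst q u) = ev (fun i => peval w (q i)) u.
Proof.
apply: (malg_ext (f := fun u : vpoly m N => ev w (subst q u))) u.
- by move=> u v; rewrite !raddfB.
- exact: ev_zmod.
by move=> x k; rewrite [in LHS]substU [LHS]evZ evC [RHS]evU powers_peval.
Qed.

End Substitution.

(** * Extension of maps to coefficients *)

Section Extension.
Variable K : fieldType.
Local Notation P n := {mpoly {poly K}[n]}.

Section Ext.
Variables (n : nat) (M N : lmodType {poly K}) (h : M -> vpoly n N).
Hypothesis hB : zmod_morphism h.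

Lemma ext_zmod : zmod_morphism (ext h).
Proof.
apply: (malg_sumB (h := fun k x => (<< k >> : P n) *: h x)) => k x y.
by rewrite hB scalerBr.
Qed.

Lemma extU x k : ext h (<< x *g k >> : vpoly n M) = (<< k >> : P n) *: h x.
Proof.
rewrite /ext (malg_sumU (h := fun k x => (<< k >> : P n) *: h x)) //.
by move=> l y z; rewrite hB scalerBr.
Qed.

End Ext.

Lemma malgUM n (k l : 'X_{1..n}) : (<< k >> : P n) * << l >> = << mmul k l >>.
Proof. by rewrite -[in RHS](mulr1 1); apply: fgmulUU. Qed.

Lemma powers_var m n (s : 'I_m -> 'I_n) k :
  exists l, powers (fun i => var (s i) : P n) k = << l >>.
Proof.
rewrite /powers; elim/big_ind: _ => [|_ _ [a ->] [b ->]|i _].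
- by exists mone.
- by exists (mmul a b); apply: malgUM.
elim: (k i) => [|e [l IH]]; first by exists mone.
exists (mmul (ucm (s i)) l).
by rewrite exprS IH; apply: malgUM.
Qed.

Lemma powers_semilinear (V W : lmodType {poly K}) m (w w' : 'I_m -> {poly K})
    (e : V -> W) k :
    (forall i x, e (w' i *: x) = w i *: e x) ->
  forall x, e (powers w' k *: x) = powers w k *: e x.
Proof.
move=> we; rewrite /powers.
elim/big_rec2: _ => [x|i a b _ IH x]; first by rewrite !scale1r.
rewrite -!scalerA; transitivity (w i ^+ k i *: e (b *: x)); last by rewrite IH.
elim: (k i) => [|d IHd]; first by rewrite !scale1r.
by rewrite !exprS -!scalerA we IHd.
Qed.

(** Applying h to the coefficients of v and then evaluating at w is not the
    same as applying h to v evaluated at w, for h does not commute with the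
    derivation: h turns the action of w' i into the action of w (s i), so it
    is at w' that v has to be evaluated. *)
Lemma ev_ext m n (M N : lmodType {poly K}) (h : M -> vpoly n N)
    (s : 'I_m -> 'I_n) (w : 'I_n -> {poly K}) (w' : 'I_m -> {poly K})
    (v : vpoly m M) :
    zmod_morphism h ->
    (forall i x, ev w (h (w' i *: x)) = w (s i) *: ev w (h x)) ->
  ev w (ext h (subst (fun i => var (s i)) v)) = ev w (h (ev w' v)).
Proof.
move=> hB hw.
apply: (malg_ext
  (f := fun v : vpoly m M => ev w (ext h (subst (fun i => var (s i)) v)))
  (g := fun v : vpoly m M => ev w (h (ev w' v)))) v => [u v|u v|x k].
- by rewrite raddfB (ext_zmod hB) raddfB.
- by rewrite raddfB hB raddfB.
rewrite [in RHS]evU (powers_semilinear (e := fun x => ev w (h x)) k hw).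
rewrite [in LHS]substU; have [l El] := powers_var s k.
rewrite El -(vpolyUE x l) (extU hB) evZ -El; congr (_ *: _).
by rewrite powers_peval; apply: eq_powers => i; rewrite peval_var.
Qed.

Lemma ev_ext1 n (M N : lmodType {poly K}) (h : M -> vpoly n N) (j : 'I_n)
    (w : 'I_n -> {poly K}) (w' : {poly K}) (v : vpoly 1 M) :
    zmod_morphism h -> (forall x, ev w (h (w' *: x)) = w j *: ev w (h x)) ->
  ev w (ext h (subst (fun=> var j) v)) = ev w (h (ev (fun=> w') v)).
Proof. by move=> hB hw; apply: (ev_ext (s := fun=> j)). Qed.

Section Coefmap.
Variables (n : nat) (M N : lmodType {poly K}) (h : M -> N).
Hypothesis hB : zmod_morphism h.

Lemma coefmap_zmod : zmod_morphism (coefmap (n := n) h).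
Proof.
apply: (malg_sumB (h := fun k x => << h x *g k >> : vpoly n N)) => k x y.
by rewrite hB monalgUB.
Qed.

Lemma coefmapU x k :
  coefmap h (<< x *g k >> : vpoly n M) = << h x *g k >>.
Proof.
rewrite /coefmap (malg_sumU (h := fun k x => << h x *g k >> : vpoly n N)) //.
by move=> l y z; rewrite hB monalgUB.
Qed.

Lemma mcoeff_coefmap (u : vpoly n M) k : (coefmap h u)@_k = h u@_k.
Proof.
apply: (malg_ext (f := fun u : vpoly n M => (coefmap h u)@_k)
                 (g := fun u => h u@_k)) u => [u v|u v|x l].
- by rewrite coefmap_zmod mcoeffB.
- by rewrite mcoeffB hB.
rewrite coefmapU [LHS]mcoeffU [in RHS]mcoeffU.
by case: (l == k); rewrite ?mulr1n // !mulr0n (zmorph0 hB).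
Qed.

Lemma ev_coefmap w (u : vpoly n M) :
  (forall c x, h (c *: x) = c *: h x) -> ev w (coefmap h u) = h (ev w u).
Proof.
move=> hZ; apply: (malg_ext (f := fun u : vpoly n M => ev w (coefmap h u))
                 (g := fun u => h (ev w u))) u => [u v|u v|x l].
- by rewrite coefmap_zmod raddfB.
- by rewrite raddfB hB.
by rewrite coefmapU [LHS]evU [in RHS]evU hZ.
Qed.

End Coefmap.

Lemma klinear_zmod n (M N : lmodType {poly K}) (h : M -> vpoly n N) :
  klinear h -> zmod_morphism h.
Proof.
move=> hl; have h0 : h 0 = 0.
  have := hl 1 0 0; rewrite scale1r addr0 mpolyC1E scale1r => E.
  by apply: (addrI (h 0)); rewrite addr0 -E.
apply: morphD_zmod => x y.
by have := hl 1 x y; rewrite scale1r mpolyC1E scale1r.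
Qed.

Lemma klinearZ n (M N : lmodType {poly K}) (h : M -> vpoly n N) :
  klinear h -> forall c x, h (c%:P *: x) = (c%:P)%:MP *: h x.
Proof.
move=> hl c x; have := hl c x 0.
by rewrite (zmorph0 (klinear_zmod hl)) !addr0.
Qed.

End Extension.

(** * Separation by scalar points *)

Section Separation.
Variable K : numFieldType.

(** In characteristic zero the points 0, ..., D - 1 are distinct, so their
    Vandermonde matrix is invertible: the coefficient of degree e0 of a
    polynomial of degree < D is a combination of its values there. *)
Lemma Vandermonde_dual D e0 :
  exists c : 'I_D -> K, forall e, (e < D)%N ->
    \sum_(j < D) c j * j%:R ^+ e = (e == e0)%:R.
Proof.
pose a : 'rV[K]_D := \row_j j%:R.
have Vu : Vandermonde D a \in unitmx.
  rewrite unitmxE det_Vandermonde unitfE; apply/prodf_neq0 => i _.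
  apply/prodf_neq0 => j ij; rewrite !mxE subr_eq0 Num.Theory.eqr_nat.
  by rewrite neq_ltn ij orbT.
pose b : 'cV[K]_D := \col_i (i == e0 :> nat)%:R.
exists (fun j => (invmx (Vandermonde D a) *m b) j 0) => e ltD.
have /matrixP/(_ (Ordinal ltD) 0) := mulKVmx Vu b.
by rewrite !mxE /= => <-; apply: eq_bigr => j _; rewrite !mxE mulrC.
Qed.

(** A coefficient is a combination of the values at a grid of scalar points,
    by Vandermonde in each variable; the coefficients may lie in any module
    over the polynomials in the derivation, torsion included. *)
Lemma ev_inj n (N : lmodType {poly K}) (u v : vpoly n N) :
  (forall p : 'I_n -> K, ev (fun i => (p i)%:P) u = ev (fun i => (p i)%:P) v) ->
  u = v.
Proof.
move=> uv; apply/eqP; rewrite -subr_eq0; apply/eqP.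
set d := u - v.
have {uv} d0 p : ev (fun i => (p i)%:P) d = 0 by rewrite ev_zmod uv subrr.
apply/malgP => k0; rewrite mcoeff0.
(* D bounds the exponents, so a grid of D points per variable suffices. *)
pose D := (\max_(k <- msupp d) \max_i k i).+1.
have ltD k i : k \in msupp d -> (k i < D)%N.
  move=> kd; rewrite ltnS; apply: leq_trans (leq_bigmax_seq _ kd isT).
  exact: (leq_bigmax i).
have [c cP] : exists c : 'I_n -> 'I_D -> K, forall i e, (e < D)%N ->
    \sum_(j < D) c i j * j%:R ^+ e = (e == k0 i)%:R.
  have /fin_all_exists [c cP] := fun i : 'I_n => Vandermonde_dual D (k0 i).
  by exists c.
have : \sum_(J : {ffun 'I_n -> 'I_D})
    (\prod_i c i (J i))%:P *: ev (fun i => ((J i)%:R)%:P) d = 0.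
  by rewrite big1 // => J _; rewrite (d0 (fun i => (J i)%:R)) scaler0.
rewrite /ev; under eq_bigr do rewrite scaler_sumr.
rewrite exchange_big /=.
rewrite (eq_big_seq (fun k => ((k == k0)%:R)%:P *: d@_k)) => [|k kd]; last first.
  under eq_bigr do rewrite scalerA.
  rewrite -scaler_suml; congr (_ *: _).
  have -> : (k == k0)%:R = \prod_i \sum_(j < D) c i j * j%:R ^+ k i.
    rewrite (eq_bigr (fun i => (k i == k0 i)%:R)) => [|i _]; last first.
      by rewrite cP // ltD.
    have [->|neq] := eqVneq k k0.
      by rewrite big1 // => i _; rewrite eqxx.
    have /existsP[i ki] : [exists i, k i != k0 i].
      apply: contraNT neq => /existsPn H; apply/cmP => i.
      by have := H i; rewrite negbK => /eqP.
    by rewrite (bigD1 i) //= (negPf ki) mul0r.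
  rewrite bigA_distr_bigA /= rmorph_sum; apply: eq_bigr => J _.
  rewrite big_split rmorphM /=; congr (_ * _).
  rewrite rmorph_prod; apply: eq_bigr => i _; by rewrite rmorphXn.
have [k0d|k0d] := boolP (k0 \in msupp d); last by rewrite mcoeff_outdom.
rewrite (big_fsetD1 k0) //= eqxx polyC1 scale1r big_seq big1 ?addr0 // => k.
by rewrite in_fsetD1 => /andP[/negPf-> _]; rewrite mulr0n polyC0 scale0r.
Qed.
End Separation.

(** * Linear identities in abelian groups *)

(** Expressions in the operations of an abelian group: an equation between two
    of them holds in every abelian group as soon as each atom has the same
    integer coefficient on both sides ([zeval_eq]), which is computed.  The
    tactic [abel] quotes both sides of the goal and runs this test. *)
Inductive zexp := ZVar of nat | ZZero | ZAdd of zexp & zexp | ZOpp of zexp.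

Fixpoint zeval (V : zmodType) (e : seq V) (t : zexp) : V :=
  match t with
  | ZVar i => e`_i
  | ZZero => 0
  | ZAdd a b => zeval e a + zeval e b
  | ZOpp a => - zeval e a
  end.

Fixpoint zcoef (i : nat) (t : zexp) : int :=
  match t with
  | ZVar j => (i == j)%:R
  | ZZero => 0
  | ZAdd a b => zcoef i a + zcoef i b
  | ZOpp a => - zcoef i a
  end.

Lemma zevalE (V : zmodType) (e : seq V) t :
  zeval e t = \sum_(i < size e) e`_i *~ zcoef i t.
Proof.
elim: t => [j||a IHa b IHb|a IHa] /=.
- have [ltj|lej] := ltnP j (size e).
    rewrite (bigD1 (Ordinal ltj)) //= eqxx big1 ?addr0 // => i.
    by rewrite -val_eqE /= => /negPf->.
  rewrite nth_default // big1 // => i _.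
  by rewrite ltn_eqF // (leq_trans (ltn_ord i)).
- by rewrite big1.
- by rewrite IHa IHb -big_split; apply: eq_bigr => i _; rewrite mulrzDr.
by rewrite IHa -sumrN; apply: eq_bigr => i _; rewrite mulrNz.
Qed.

Lemma zeval_eq (V : zmodType) (e : seq V) s t :
    all (fun i => zcoef i s == zcoef i t) (iota 0 (size e)) ->
  zeval e s = zeval e t.
Proof.
move=> /allP st; rewrite !zevalE; apply: eq_bigr => i _.
by rewrite (eqP (st i _)) // mem_iota /= add0n.
Qed.

Ltac zatom_index x e :=
  match e with
  | x :: _ => constr:(0%N)
  | ?y :: _ => let _ := match constr:(Set) with _ => unify x y end in
               constr:(0%N)
  | _ :: ?e' => let i := zatom_index x e' in constr:(S i)
  end.
Ltac zatom_add x e :=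
  match e with
  | _ => let _ := zatom_index x e in constr:(e)
  | _ => constr:(x :: e)
  end.
Ltac zatoms t e :=
  lazymatch t with
  | (?a + ?b)%R => let e' := zatoms a e in zatoms b e'
  | (- ?a)%R => zatoms a e
  | 0%R => constr:(e)
  | _ => zatom_add t e
  end.
Ltac zquote t e :=
  lazymatch t with
  | (?a + ?b)%R =>
      let a' := zquote a e in let b' := zquote b e in constr:(ZAdd a' b')
  | (- ?a)%R => let a' := zquote a e in constr:(ZOpp a')
  | 0%R => constr:(ZZero)
  | _ => let i := zatom_index t e in constr:(ZVar i)
  end.
Ltac abel :=
  lazymatch goal with
  | |- @eq ?T ?u ?v =>
    let e := zatoms u (@nil T) in
    let e := zatoms v e in
    let s := zquote u e in
    let t := zquote v e in
    exact (@zeval_eq _ e s t isT)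
  end.

(** * Cartan calculus *)

Definition neg_if (V : zmodType) (b : bool) (v : V) := if b then - v else v.

Lemma neg_if_zmod (V : zmodType) b : zmod_morphism (@neg_if V b).
Proof. by case: b => u v //=; abel. Qed.

Lemma neg_if_negb (V : zmodType) b (v : V) : neg_if (~~ b) v = - neg_if b v.
Proof. by case: b; rewrite /= ?opprK. Qed.

Definition del (T : Type) i (s : seq T) := take i s ++ drop i.+1 s.

(** A Lie algebra graded by G with a representation on V, all identities
    holding up to negligible vectors: Z g v reads v = 0 in degree g.  The
    action of x on a vector may depend on the degree g of that vector.
    Homogeneous elements of different degrees cannot be added, so H carries no
    addition, and comb c x y z reads c x + y = z; for elements, comb 1 x y o
    with o negligible reads x = - y, and comb 1 o o o says that o is
    negligible. *)
Record graded_lie (K : nzRingType) (V : zmodType) (G : nmodType) (H : Type)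
    (sc : K -> V -> V) (deg : H -> G) (br : H -> H -> H) (act : H -> G -> V -> V)
    (Z : G -> V -> Prop) (comb : K -> H -> H -> H -> Prop) : Prop := {
  gl_Z0 : forall g, Z g 0;
  gl_ZB : forall g u v, Z g u -> Z g v -> Z g (u - v);
  gl_scB : forall c, zmod_morphism (sc c);
  gl_sc1 : forall v, sc 1 v = v;
  gl_degM : forall x y, deg (br x y) = deg x + deg y;
  gl_actB : forall x g, zmod_morphism (act x g);
  gl_actC : forall x g c v, act x g (sc c v) = sc c (act x g v);
  gl_act_Z : forall x g v, Z g v -> Z (g + deg x) (act x g v);
  gl_act_comm : forall x y g v, Z (g + deg x + deg y)
    (act x (g + deg y) (act y g v) - act y (g + deg x) (act x g v)
     - act (br x y) g v);
  gl_comb_deg : forall c x y z, comb c x y z -> deg y = deg x /\ deg z = deg x;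
  gl_comb_act : forall c x y z g v, comb c x y z ->
    Z (g + deg x) (sc c (act x g v) + act y g v - act z g v);
  gl_comb_brl : forall c x y z w, comb c x y z ->
    comb c (br x w) (br y w) (br z w);
  gl_comb_brr : forall c x y z w, comb c x y z ->
    comb c (br w x) (br w y) (br w z);
  gl_comb_jacobi : forall x y z,
    comb 1 (br (br x y) z) (br y (br x z)) (br x (br y z));
  gl_comb_skew : forall x y, exists2 o, comb 1 (br x y) (br y x) o & comb 1 o o o
}.

Section CartanCalculus.
Variables (K : nzRingType) (V : zmodType) (G : nmodType) (H : Type).
Variables (sc : K -> V -> V) (deg : H -> G) (br : H -> H -> H).
Variables (act : H -> G -> V -> V) (Z : G -> V -> Prop).
Variable comb : K -> H -> H -> H -> Prop.
Hypothesis gl : graded_lie sc deg br act Z comb.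

Let Z0 := gl_Z0 gl.
Let ZB := gl_ZB gl.
Let scB := gl_scB gl.
Let sc1 := gl_sc1 gl.
Let degM := gl_degM gl.
Let actB := gl_actB gl.
Let actC := gl_actC gl.
Let act_Z := gl_act_Z gl.
Let act_comm := gl_act_comm gl.
Let comb_deg := gl_comb_deg gl.
Let comb_act := gl_comb_act gl.
Let comb_brl := gl_comb_brl gl.
Let comb_brr := gl_comb_brr gl.
Let comb_jacobi := gl_comb_jacobi gl.
Let comb_skew := gl_comb_skew gl.

Lemma ZN g u : Z g u -> Z g (- u).
Proof. by move=> u0; rewrite -sub0r; apply: ZB. Qed.

Lemma ZD g u v : Z g u -> Z g v -> Z g (u + v).
Proof. by move=> u0 v0; rewrite -[v]opprK; apply: ZB => //; apply: ZN. Qed.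

Lemma Zeq g u v : u = v -> Z g u -> Z g v.
Proof. by move->. Qed.

Implicit Types (F : seq H -> V) (s : seq H).

Definition mom g s := foldl (fun g x => g + deg x) g s.

Lemma momE g s : mom g s = g + \sum_(x <- s) deg x.
Proof.
elim: s g => [|x s IH] g; first by rewrite big_nil addr0.
by rewrite big_cons /= IH addrA.
Qed.

Lemma mom_cons g x s : mom g (x :: s) = mom (g + deg x) s.
Proof. by []. Qed.

Definition vanishes n g F := forall s, size s = n -> Z (mom g s) (F s).

(** Multilinearity, stated through [comb]; as [comb] holds up to negligible
    vectors only, it also says that F does not see those. *)
Definition respects g F := forall s1 s2 c x y z, comb c x y z ->
  Z (mom g (s1 ++ x :: s2))
    (sc c (F (s1 ++ x :: s2)) + F (s1 ++ y :: s2) - F (s1 ++ z :: s2)).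

Definition alternating g F := forall s1 s2 x y,
  Z (mom g (s1 ++ x :: y :: s2)) (F (s1 ++ x :: y :: s2) + F (s1 ++ y :: x :: s2)).

(** The Lie derivative of a cochain, from i_y L_x = L_x i_y - i_[x, y] where
    i_y F t = F (y :: t).  The degree g is that of F on the empty list, and
    grows by the degree of y when y becomes a fixed argument of F. *)
Fixpoint lieD x g F s : V :=
  if s is y :: s' then
    lieD x (g + deg y) (fun t => F (y :: t)) s' - F (br x y :: s')
  else act x g (F [::]).

(** The differential, from Cartan's formula i_x d = L_x - d i_x. *)
Fixpoint cartanD g F s : V :=
  if s is x :: s' then
    lieD x g F s' - cartanD (g + deg x) (fun t => F (x :: t)) s'
  else 0.

Lemma lieD_sub x g F F' s :
  lieD x g (fun t => F t - F' t) s = lieD x g F s - lieD x g F' s.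
Proof.
elim: s g F F' => [|y s IH] g F F' /=; first by rewrite actB.
by rewrite (IH _ (fun t => F (y :: t)) (fun t => F' (y :: t))); abel.
Qed.

Lemma lieD_add x g F F' s :
  lieD x g (fun t => F t + F' t) s = lieD x g F s + lieD x g F' s.
Proof.
elim: s g F F' => [|y s IH] g F F' /=; first by rewrite (zmorphD (actB x g)).
by rewrite (IH _ (fun t => F (y :: t)) (fun t => F' (y :: t))); abel.
Qed.

Lemma lieD_scale x g c F s :
  lieD x g (fun t => sc c (F t)) s = sc c (lieD x g F s).
Proof.
elim: s g F => [|y s IH] g F /=; first by rewrite actC.
by rewrite (IH _ (fun t => F (y :: t))) scB.
Qed.

Lemma cartanD_sub g F F' s :
  cartanD g (fun t => F t - F' t) s = cartanD g F s - cartanD g F' s.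
Proof.
elim: s g F F' => [|x s IH] g F F' /=; first by rewrite subr0.
by rewrite lieD_sub (IH _ (fun t => F (x :: t)) (fun t => F' (x :: t))); abel.
Qed.

Lemma cartanD_add g F F' s :
  cartanD g (fun t => F t + F' t) s = cartanD g F s + cartanD g F' s.
Proof.
elim: s g F F' => [|x s IH] g F F' /=; first by rewrite addr0.
by rewrite lieD_add (IH _ (fun t => F (x :: t)) (fun t => F' (x :: t))); abel.
Qed.

Lemma cartanD_scale g c F s :
  cartanD g (fun t => sc c (F t)) s = sc c (cartanD g F s).
Proof.
elim: s g F => [|x s IH] g F /=; first by rewrite (zmorph0 (scB c)).
by rewrite lieD_scale (IH _ (fun t => F (x :: t))) scB.
Qed.

Lemma lieD_vanishes n x g F : vanishes n g F -> vanishes n (g + deg x) (lieD x g F).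
Proof.
elim: n g F => [|n IH] g F F0 [|y s] //= => [_|[sz]].
  by apply: act_Z; apply: (F0 [::]).
apply: ZB.
  rewrite addrAC; apply: IH => // t tn; apply: (F0 (y :: t)).
  by rewrite /= tn.
have := F0 (br x y :: s); rewrite mom_cons degM addrA.
by apply; rewrite /= sz.
Qed.

Lemma cartanD_vanishes n g F : vanishes n g F -> vanishes n.+1 g (cartanD g F).
Proof.
elim: n g F => [|n IH] g F F0 [|x s] //= [sz].
  by case: s sz => // _; rewrite /= subr0; apply: act_Z; apply: (F0 [::]).
apply: ZB; first exact: lieD_vanishes F0 _ sz.
by apply: IH => // t tn; apply: (F0 (x :: t)); rewrite /= tn.
Qed.

(** The Leibniz rule: on the empty list it is the representation identity of
    [act], and each further argument contributes one Jacobi identity, inside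
    an argument of F. *)
Lemma lieD_comm x y g F s : respects g F ->
  Z (mom (g + deg x + deg y) s)
    (lieD x (g + deg y) (lieD y g F) s - lieD y (g + deg x) (lieD x g F) s
     - lieD (br x y) g F s).
Proof.
elim: s g F => [|z s IH] g F Fr /=; first exact: act_comm.
have := IH (g + deg z) (fun t => F (z :: t)) (fun s1 => Fr (z :: s1)).
rewrite (addrAC g (deg z) (deg x)) (addrAC g (deg z) (deg y)).
rewrite (addrAC (g + deg x) (deg z) (deg y)) => E.
have := Fr [::] s _ _ _ _ (comb_jacobi x y z).
rewrite !cat0s mom_cons !degM sc1 => E'.
rewrite (lieD_sub x _ (lieD y (g + deg z) (fun t => F (z :: t)))
                   (fun t => F (br y z :: t))).
rewrite (lieD_sub y _ (lieD x (g + deg z) (fun t => F (z :: t)))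
                   (fun t => F (br x z :: t))).
rewrite !addrA; rewrite !addrA in E'.
by apply: (Zeq _ (ZD E E')); abel.
Qed.

(** d L_y = L_y d, by induction: contracting with an element x and using
    i_x d = L_x - d i_x leaves [L_x, L_y] = L_[x, y]. *)
Lemma cartanD_lieD x g F s : respects g F ->
  Z (mom (g + deg x) s)
    (cartanD (g + deg x) (lieD x g F) s - lieD x g (cartanD g F) s).
Proof.
elim: s g F => [|y s IH] g F Fr /=.
  by rewrite (zmorph0 (actB x g)) subr0; apply: Z0.
have := IH (g + deg y) (fun t => F (y :: t)) (fun s1 => Fr (y :: s1)).
rewrite (addrAC g (deg y) (deg x)) => E.
have E' := lieD_comm x y s Fr.
rewrite (cartanD_sub _ (lieD x (g + deg y) (fun t => F (y :: t)))
                 (fun t => F (br x y :: t))).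
rewrite (lieD_sub x _ (lieD y g F) (cartanD (g + deg y) (fun t => F (y :: t)))).
rewrite degM addrA.
by apply: (Zeq _ (ZN (ZD E E'))); abel.
Qed.

(** i_x d d = L_x d - d i_x d = L_x d - d L_x + d d i_x, where the first two
    terms cancel and the last one is the induction hypothesis. *)
Lemma cartanD_cartanD g F s : respects g F ->
  Z (mom g s) (cartanD g (cartanD g F) s).
Proof.
elim: s g F => [|x s IH] g F Fr /=; first exact: Z0.
rewrite (cartanD_sub _ (lieD x g F) (cartanD (g + deg x) (fun t => F (x :: t)))).
have E := IH (g + deg x) (fun t => F (x :: t)) (fun s1 => Fr (x :: s1)).
by apply: (Zeq _ (ZB E (cartanD_lieD x s Fr))); abel.
Qed.

Lemma lieD_comb c x y z g F s : comb c x y z -> respects g F ->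
  Z (mom (g + deg x) s)
    (sc c (lieD x g F s) + lieD y g F s - lieD z g F s).
Proof.
move=> cxyz; elim: s g F => [|w s IH] g F Fr /=; first exact: comb_act.
have := IH (g + deg w) (fun t => F (w :: t)) (fun s1 => Fr (w :: s1)).
rewrite (addrAC g (deg w)) => E.
have := Fr [::] s _ _ _ _ (comb_brl w cxyz).
rewrite !cat0s mom_cons degM addrA => E'.
by apply: (Zeq _ (ZB E E')); rewrite scB; abel.
Qed.

Lemma lieD_respects w g F : respects g F -> respects (g + deg w) (lieD w g F).
Proof.
move=> Fr s1 s2 c x y z cxyz.
elim: s1 g F Fr => [|h s1 IH] g F Fr.
  rewrite !cat0s /=; have [-> ->] := comb_deg cxyz.
  have E : Z (mom (g + deg x + deg w) s2) (lieD w (g + deg x) (fun t =>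
      sc c (F (x :: t)) + F (y :: t) - F (z :: t)) s2).
    apply: lieD_vanishes (erefl (size s2)) => t _.
    exact: (Fr [::] t _ _ _ _ cxyz).
  rewrite (lieD_sub w _ (fun t => sc c (F (x :: t)) + F (y :: t))) in E.
  rewrite (lieD_add w _ (fun t => sc c (F (x :: t)))) lieD_scale in E.
  rewrite addrAC in E.
  have := Fr [::] s2 _ _ _ _ (comb_brr w cxyz).
  rewrite !cat0s mom_cons degM addrA => E'.
  by apply: (Zeq _ (ZB E E')); rewrite scB; abel.
have := IH (g + deg h) (fun t => F (h :: t)) (fun s1 => Fr (h :: s1)).
rewrite (addrAC g (deg h)) !cat_cons => E.
have := Fr (br w h :: s1) s2 _ _ _ _ cxyz.
rewrite !cat_cons mom_cons degM addrA => E'.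
by apply: (Zeq _ (ZB E E')); rewrite /= scB; abel.
Qed.

Lemma lieD_alternating w g F :
  alternating g F -> alternating (g + deg w) (lieD w g F).
Proof.
move=> Fa s1 s2 x y; elim: s1 g F Fa => [|h s1 IH] g F Fa.
  rewrite !cat0s /=.
  have E : Z (mom (g + deg x + deg y + deg w) s2)
      (lieD w (g + deg x + deg y)
        (fun t => F (x :: y :: t) + F (y :: x :: t)) s2).
    apply: lieD_vanishes (erefl (size s2)) => t _; exact: (Fa [::] t x y).
  rewrite lieD_add (addrAC (g + deg x)) (addrAC g (deg x) (deg w)) in E.
  have := Fa [::] s2 x (br w y); rewrite !cat0s !mom_cons degM addrA.
  rewrite (addrAC g (deg x) (deg w)) => E1.
  have := Fa [::] s2 (br w x) y; rewrite !cat0s !mom_cons degM addrA => E2.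
  rewrite (addrAC g (deg y) (deg x)).
  by apply: (Zeq _ (ZB (ZB E E1) E2)); abel.
have := IH (g + deg h) (fun t => F (h :: t)) (fun s1 => Fa (h :: s1)).
rewrite (addrAC g (deg h)) !cat_cons => E.
have := Fa (br w h :: s1) s2 x y.
rewrite !cat_cons mom_cons degM addrA => E'.
by apply: (Zeq _ (ZB E E')); rewrite /=; abel.
Qed.

Lemma cartanD_respects g F : respects g F -> respects g (cartanD g F).
Proof.
move=> Fr s1 s2 c x y z cxyz.
elim: s1 g F Fr => [|h s1 IH] g F Fr.
  rewrite !cat0s /=; have [dy dz] := comb_deg cxyz; rewrite dy dz.
  have E := lieD_comb s2 cxyz Fr.
  have E' : Z (mom (g + deg x) s2) (cartanD (g + deg x) (fun t =>
      sc c (F (x :: t)) + F (y :: t) - F (z :: t)) s2).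
    case: s2 {E} => [|h s2]; first exact: Z0.
    apply: cartanD_vanishes (erefl (size (h :: s2))) => t _.
    exact: (Fr [::] t _ _ _ _ cxyz).
  rewrite (cartanD_sub _ (fun t => sc c (F (x :: t)) + F (y :: t))) in E'.
  rewrite (cartanD_add _ (fun t => sc c (F (x :: t)))) cartanD_scale in E'.
  by apply: (Zeq _ (ZB E E')); rewrite scB; abel.
have E := IH (g + deg h) (fun t => F (h :: t)) (fun s1 => Fr (h :: s1)).
have E' := lieD_respects h Fr s1 s2 cxyz.
by apply: (Zeq _ (ZB E' E)); rewrite /= scB; abel.
Qed.

(** On two leading arguments the differential is
    L_x i_y - L_y i_x - i_[x, y] + d i_y i_x.  Exchanging x and y changes the
    sign of this: for the last term because F is alternating, for the third
    one because [y, x] = - [x, y]. *)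
Lemma cartanD_alternating g F :
  alternating g F -> respects g F -> alternating g (cartanD g F).
Proof.
move=> Fa Fr s1 s2 x y; elim: s1 g F Fa Fr => [|h s1 IH] g F Fa Fr.
  rewrite !cat0s /= (addrAC g (deg y) (deg x)).
  have E : Z (mom (g + deg x + deg y) s2) (cartanD (g + deg x + deg y)
        (fun t => F (x :: y :: t) + F (y :: x :: t)) s2).
    case: s2 => [|h s2]; first exact: Z0.
    apply: cartanD_vanishes (erefl (size (h :: s2))) => t _.
    exact: (Fa [::] t x y).
  rewrite cartanD_add in E.
  have [o xyo ooo] := comb_skew x y.
  have := Fr [::] s2 _ _ _ _ xyo.
  have := Fr [::] s2 _ _ _ _ ooo.
  have [_ dego] := comb_deg xyo.
  rewrite !cat0s !mom_cons dego degM addrA !sc1 => E1 E2.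
  by apply: (Zeq _ (ZB (ZB E E1) E2)); abel.
have E := IH (g + deg h) (fun t => F (h :: t)) (fun s1 => Fa (h :: s1))
  (fun s1 => Fr (h :: s1)).
have E' := lieD_alternating h Fa s1 s2 x y.
by apply: (Zeq _ (ZB E' E)); rewrite /=; abel.
Qed.

Lemma Zsum g I (r : seq I) (Q : pred I) (f : I -> V) :
  (forall i, Q i -> Z g (f i)) -> Z g (\sum_(i <- r | Q i) f i).
Proof.
move=> Zf; elim/big_ind: _ => [|u v Zu Zv|i Qi]; first exact: Z0.
  exact: ZD.
exact: Zf.
Qed.

Lemma Z_neg_if g b u : Z g u -> Z g (neg_if b u).
Proof. by case: b => //; apply: ZN. Qed.

(** The formula of Chevalley and Eilenberg on lists. *)
Definition ce_sum x0 g F s : V :=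
  \sum_(i < size s)
     neg_if (odd i) (act (nth x0 s i) (mom g (del i s)) (F (del i s)))
  + \sum_(i < size s) \sum_(j < size s | (i < j)%N)
     neg_if (odd (i + j)) (F (br (nth x0 s i) (nth x0 s j) :: del i (del j s))).

Lemma lieDE x0 x g F s :
  lieD x g F s = act x (mom g s) (F s)
    - \sum_(j < size s) F (take j s ++ br x (nth x0 s j) :: drop j.+1 s).
Proof.
elim: s g F => [|y s IH] g F; first by rewrite big_ord0 subr0.
rewrite /= IH /= big_ord_recl /= drop0.
by rewrite (eq_bigr (fun j : 'I_(size s) =>
  F (y :: take j s ++ br x (nth x0 s j) :: drop j.+1 s))) //; abel.
Qed.

Lemma mom_insert g s1 s2 u : mom g (s1 ++ u :: s2) = mom g (u :: s1 ++ s2).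
Proof.
rewrite !momE; congr (_ + _).
by rewrite big_cat [RHS]big_cons big_cons big_cat /= addrCA.
Qed.

Lemma mom_del x0 g s i : (i < size s)%N ->
  mom g s = mom (g + deg (nth x0 s i)) (del i s).
Proof.
by move=> lti; rewrite -mom_cons -mom_insert -drop_nth // cat_take_drop.
Qed.

(** Moving an argument to the front past s1 costs one sign per element. *)
Lemma alternating_front g F s1 s2 u : alternating g F ->
  Z (mom g (u :: s1 ++ s2))
    (F (s1 ++ u :: s2) - neg_if (odd (size s1)) (F (u :: s1 ++ s2))).
Proof.
elim: s1 g F => [|h s1 IH] g F Fa; first by rewrite subrr; apply: Z0.
have E := IH (g + deg h) (fun t => F (h :: t)) (fun s1 => Fa (h :: s1)).
have /(Z_neg_if (odd (size s1))) E' := Fa [::] (s1 ++ s2) u h.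
rewrite /= neg_if_negb; rewrite /= addrAC in E; rewrite /= in E'.
apply: (Zeq _ (ZD E E')); rewrite (zmorphD (@neg_if_zmod _ _)); abel.
Qed.

Lemma ce_sum_cons x0 g F h s :
  ce_sum x0 g F (h :: s) = act h (mom g s) (F s)
    - \sum_(j < size s) neg_if (odd j) (F (br h (nth x0 s j) :: del j s))
    - \sum_(i < size s) neg_if (odd i)
        (act (nth x0 s i) (mom (g + deg h) (del i s)) (F (h :: del i s)))
    + \sum_(i < size s) \sum_(j < size s | (i < j)%N) neg_if (odd (i + j))
        (F (br (nth x0 s i) (nth x0 s j) :: h :: del i (del j s))).
Proof.
rewrite /ce_sum ![in LHS]big_ord_recl.
have -> : neg_if (odd (@ord0 (size s))) (act (nth x0 (h :: s) (@ord0 (size s)))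
    (mom g (del (@ord0 (size s)) (h :: s)))
    (F (del (@ord0 (size s)) (h :: s)))) = act h (mom g s) (F s).
  by rewrite /del /= drop0.
rewrite -!addrA; congr (_ + _); rewrite !addrA.
rewrite [X in X + _ + _](_ : _ = - \sum_(i < size s) neg_if (odd i)
    (act (nth x0 s i) (mom (g + deg h) (del i s)) (F (h :: del i s)))); last first.
  by rewrite -sumrN; apply: eq_bigr => i _; rewrite /= neg_if_negb.
rewrite [X in _ + X + _](_ : _ = - \sum_(j < size s)
    neg_if (odd j) (F (br h (nth x0 s j) :: del j s))); last first.
  rewrite big_mkcond big_ord_recl /= add0r -sumrN; apply: eq_bigr => i _.
  by rewrite /= neg_if_negb /del /= drop0.
rewrite [X in _ + X](_ : _ = \sum_(i < size s) \sum_(j < size s | (i < j)%N)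
    neg_if (odd (i + j))
    (F (br (nth x0 s i) (nth x0 s j) :: h :: del i (del j s)))); last first.
  apply: eq_bigr => i _; rewrite big_mkcond big_ord_recl /= add0r.
  rewrite [RHS]big_mkcond; apply: eq_bigr => j _ /=.
  by rewrite /bump !add1n ltnS addnS /= negbK.
congr (_ + _); exact: addrC.
Qed.

(** Peeling off the first argument h splits the sum into the terms that
    differentiate along h, the terms with h inside the bracket, and the terms
    of i_h F.  The first two are L_h, up to moving the bracket to the front,
    and the last ones are those of - d i_h, up to exchanging h and the
    bracket. *)
Lemma ce_sumE x0 g F s : alternating g F ->
  Z (mom g s) (ce_sum x0 g F s - cartanD g F s).
Proof.
elim: s g F => [|h s IH] g F Fa.
  by rewrite /ce_sum !big_ord0 /= addr0 subr0; apply: Z0.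
have E := IH (g + deg h) (fun t => F (h :: t)) (fun s1 => Fa (h :: s1)).
pose A := \sum_(j < size s)
  (F (take j s ++ br h (nth x0 s j) :: drop j.+1 s) -
     neg_if (odd j) (F (br h (nth x0 s j) :: del j s))).
pose B := \sum_(i < size s) \sum_(j < size s | (i < j)%N) neg_if (odd (i + j))
  (F (br (nth x0 s i) (nth x0 s j) :: h :: del i (del j s)) +
   F (h :: br (nth x0 s i) (nth x0 s j) :: del i (del j s))).
have ZA : Z (mom g (h :: s)) A.
  apply: Zsum => j _; rewrite mom_cons (mom_del x0 _ (ltn_ord j)).
  have := alternating_front (take j s) (drop j.+1 s) (br h (nth x0 s j)) Fa.
  by rewrite size_take ltn_ord mom_cons degM addrA.
have ZB' : Z (mom g (h :: s)) B.
  apply: Zsum => i _; apply: Zsum => j ltij; apply: Z_neg_if.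
  have := Fa [::] (del i (del j s)) (br (nth x0 s i) (nth x0 s j)) h.
  rewrite cat0s !mom_cons (mom_del x0 _ (ltn_ord j)).
  have ltid : (i < size (del j s))%N.
    by rewrite size_cat size_take ltn_ord ltn_addr.
  rewrite (mom_del x0 _ ltid) degM [nth x0 (del j s) i]nth_cat size_take ltn_ord.
  rewrite ltij nth_take // addrA (addrAC _ _ (deg h)) (addrAC _ _ (deg h)).
  by rewrite (addrAC _ (deg (nth x0 s i))).
apply: (Zeq _ (ZB (ZD ZA ZB') E)).
rewrite ce_sum_cons /= (lieDE x0) /A /B /ce_sum sumrB.
rewrite [X in _ + X - _](_ : _ =
  \sum_(i < size s) \sum_(j < size s | (i < j)%N) neg_if (odd (i + j))
    (F (br (nth x0 s i) (nth x0 s j) :: h :: del i (del j s))) +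
  \sum_(i < size s) \sum_(j < size s | (i < j)%N) neg_if (odd (i + j))
    (F (h :: br (nth x0 s i) (nth x0 s j) :: del i (del j s)))); last first.
  rewrite -big_split; apply: eq_bigr => i _; rewrite -big_split.
  by apply: eq_bigr => j _; apply: (zmorphD (@neg_if_zmod _ _)).
abel.
Qed.

End CartanCalculus.

(** * Momenta *)

Section Weights.
Variable K : fieldType.

(** (p, k): p is the sum of the values of the scalar variables of the arguments
    that make up an element, k the number of those among them whose variable
    is eliminated. *)
Definition momentum := (K * nat)%type.
HB.instance Definition _ := GRing.Nmodule.on momentum.
Implicit Types (g t x y : momentum).

(** The value of the variable of an argument of momentum g when the momentum of
    all the arguments is t: the scalar p itself, or, for the argument to be
    eliminated, - (sum of the others) - ∂. *)
Definition weight t g : {poly K} :=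
  if g.2 == 0%N then g.1%:P else - (t.1 - g.1)%:P - 'X.

(** The sum of all the variables plus ∂: when nothing is eliminated it has to
    be divided out, otherwise it is zero by construction. *)
Definition modulus g : {poly K} := if g.2 == 0%N then 'X + g.1%:P else 0.

(** With two or more eliminated arguments the values [weight] are meaningless
    (they do not add up), hence the bound on k. *)
Definition negligible (N : lmodType {poly K}) g (v : N) : Prop :=
  (g.2 <= 1)%N -> exists w, v = modulus g *: w.

Section Negligible.
Variable N : lmodType {poly K}.
Implicit Types (v : N).

Lemma negligible0 g : negligible g (0 : N).
Proof. by move=> _; exists 0; rewrite scaler0. Qed.

Lemma negligibleB g u v :
  negligible g u -> negligible g v -> negligible g (u - v).
Proof.
move=> nu nv g1; have [u' ->] := nu g1; have [v' ->] := nv g1.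
by exists (u' - v'); rewrite scalerBr.
Qed.

Lemma negligible_full g v : g.2 = 1%N -> negligible g v -> v = 0.
Proof.
move=> g1 nv; have [|w ->] := nv; first by rewrite g1.
by rewrite /modulus g1 scale0r.
Qed.

End Negligible.

Ltac weight_cases :=
  repeat match goal with
  | g : momentum |- _ => case: g => ? [|[|?]]
  end; rewrite /weight /modulus //= => _;
  do ?rewrite !(comp_polyD, comp_polyB, comp_polyC, comp_polyX, comp_poly0,
            raddfN, polyCD, polyCB) /=; ring.

Lemma weightD t x y : ((x + y)%R.2 <= 1)%N ->
  weight t (x + y) = weight t x + weight t y.
Proof. by weight_cases. Qed.

Lemma weight_self t : (t.2 <= 1)%N -> weight t t + 'X = modulus t.
Proof. weight_cases. Qed.

(** Acting by x shifts the derivation by the variable of x.  This is exactly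
    how the value of the variable of y changes when x joins the arguments. *)
Lemma weight_comp g x y : ((g + x + y)%R.2 <= 1)%N ->
  weight (g + y) y \Po ('X + weight (g + x + y) x) = weight (g + x + y) y.
Proof. weight_cases. Qed.

(** In {x y} the derivation acts as minus the total variable once the bracket
    itself is an argument, which turns the value of the variable of x inside
    the bracket into its value among all the arguments. *)
Lemma weight_compN g x y : ((g + x + y)%R.2 <= 1)%N ->
  weight (x + y) x \Po (- weight (g + x + y) (x + y)) = weight (g + x + y) x.
Proof. weight_cases. Qed.

Lemma modulus_comp g x : ((g + x)%R.2 <= 1)%N ->
  modulus g \Po ('X + weight (g + x) x) = modulus (g + x).
Proof. weight_cases. Qed.

Lemma modulus_compN g x : ((g + x)%R.2 <= 1)%N ->
  modulus x \Po (- weight (g + x) x) = 0.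
Proof. weight_cases. Qed.

End Weights.

Arguments negligible0 {K} N g _.
Arguments negligibleB {K N g u v} nu nv _.

(** * Conformal modules at homogeneous elements *)

(** Powers respect congruences modulo d, hence so does evaluation
    ([ev_congr]). *)
Lemma powers_congr (S : comRingType) n (d : S) (w w' : 'I_n -> S) k :
    (forall i, exists e, w i = w' i + d * e) ->
  exists e, powers w k = powers w' k + d * e.
Proof.
move=> ww; rewrite /powers.
elim/big_rec2: _ => [|i b _ _ [e ->]]; first by exists 0; rewrite mulr0 addr0.
have [f ->] : exists f, w i ^+ k i = w' i ^+ k i + d * f.
  elim: (k i) => [|l [f IH]]; first by exists 0; rewrite mulr0 addr0.
  rewrite exprS IH exprS; have [e' ->] := ww i.
  by exists (w' i * f + e' * w' i ^+ l + e' * d * f); ring.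
by move: (w' i ^+ k i) => A; exists (A * e + f * b + f * d * e); ring.
Qed.

Lemma ev_congr (K : fieldType) n (N : lmodType {poly K}) (d : {poly K})
    (w w' : 'I_n -> {poly K}) (u : vpoly n N) :
    (forall i, exists e, w i = w' i + d * e) ->
  exists v, ev w u - ev w' u = d *: v.
Proof.
move=> ww; rewrite [u]monalgE; elim/big_ind: _ => [|u1 u2 [v1 E1] [v2 E2]|k _].
- by exists 0; rewrite !(zmorph0 (ev_zmod _)) subr0 scaler0.
- exists (v1 + v2); rewrite scalerDr -E1 -E2 !(zmorphD (ev_zmod _)); abel.
have [e E] := powers_congr k ww; exists (e *: u@_k).
by rewrite !evU -scalerBl E scalerA addrAC subrr add0r.
Qed.

Section ConformalModule.
Variable K : fieldType.
Variables (a M : lmodType {poly K}) (br : a -> a -> vpoly 1 a).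
Variable rho : a -> M -> vpoly 1 M.
Hypothesis mod_M : is_lca_module br rho.

(** The operator rho(x)_lambda at lambda = w, where w may involve the
    derivation, acting from the left on coefficients. *)
Definition act_at (w : {poly K}) (x : a) (m : M) : M := ev (fun=> w) (rho x m).

Lemma act_at_zmodl w m : zmod_morphism (act_at w ^~ m).
Proof.
by move=> x y; rewrite /act_at (klinear_zmod (lcm_linl mod_M m)) ev_zmod.
Qed.

Lemma act_at_zmodr w x : zmod_morphism (act_at w x).
Proof.
by move=> m n; rewrite /act_at (klinear_zmod (lcm_linr mod_M x)) ev_zmod.
Qed.

Lemma act_atZr w x q m : act_at w x (q *: m) = (q \Po ('X + w)) *: act_at w x m.
Proof.
elim/poly_ind: q m => [|q c IH] m.
  by rewrite comp_poly0 !scale0r (zmorph0 (act_at_zmodr w x)).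
rewrite comp_polyD comp_polyM comp_polyX comp_polyC !scalerDl.
rewrite (zmorphD (act_at_zmodr w x)) -!scalerA IH; congr (_ + _).
  apply: (congr1 (fun z => _ *: z)).
  by rewrite /act_at (lcm_dr mod_M) evZ peval_dparDvar.
by rewrite /act_at (klinearZ (lcm_linr mod_M x)) evZ peval_malgC.
Qed.

Lemma act_atZl w x q m : act_at w (q *: x) m = (q \Po (- w)) *: act_at w x m.
Proof.
elim/poly_ind: q x => [|q c IH] x.
  by rewrite comp_poly0 !scale0r (zmorph0 (act_at_zmodl w m)).
rewrite comp_polyD comp_polyM comp_polyX comp_polyC !scalerDl.
rewrite (zmorphD (act_at_zmodl w m)) -!scalerA IH; congr (_ + _).
  apply: (congr1 (fun z => _ *: z)).
  by rewrite /act_at (lcm_dl mod_M) evZ peval_Nvar.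
by rewrite /act_at (klinearZ (lcm_linl mod_M m)) evZ peval_malgC.
Qed.

End ConformalModule.

Section Commutator.
Variable K : fieldType.
Variables (a M : lmodType {poly K}) (br : a -> a -> vpoly 1 a).
Variable rho : a -> M -> vpoly 1 M.
Hypothesis mod_M : is_lca_module br rho.

(** The values lam and mu of the two variables may involve the derivation, and
    rho(x)_lam shifts it by lam; the inner operators must be taken at values
    ny, nx, nxy that become mu, lam, lam after this shift (after replacing the
    derivation by - (lam + mu) inside the bracket). *)
Lemma act_at_comm (lam mu nx ny nxy : {poly K}) x y m :
    ny \Po ('X + lam) = mu -> nx \Po ('X + mu) = lam ->
    nxy \Po (- (lam + mu)) = lam ->
  act_at rho lam x (act_at rho ny y m) - act_at rho mu y (act_at rho nx x m) =
  act_at rho (lam + mu) (act_at br nxy x y) m.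
Proof.
move=> Ey Ex Exy.
pose w (i : 'I_2) := if i == 0 then lam else mu.
have w0 : w 0 = lam by [].
have w1 : w 1 = mu by [].
have Rl z v : ev w (subst (fun=> var 0) (rho z v)) = act_at rho lam z v.
  by rewrite ev_subst; apply: eq_ev => i; rewrite peval_var.
have Rm z v : ev w (subst (fun=> var 1) (rho z v)) = act_at rho mu z v.
  by rewrite ev_subst; apply: eq_ev => i; rewrite peval_var.
have Rlm z v : ev w (subst (fun=> var 0 + var 1) (rho z v))
    = act_at rho (lam + mu) z v.
  by rewrite ev_subst; apply: eq_ev => i; rewrite peval_varDvar.
have E1 : ev w (ext (fun v => subst (fun=> var 0) (rho x v))
    (subst (fun=> var 1) (rho y m))) = act_at rho lam x (act_at rho ny y m).
  refine (etrans (@ev_ext1 K 2 M M (fun v => subst (fun=> var 0) (rho x v))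
                    1 w ny (rho y m) _ _) (Rl _ _)) => [u v|v].
    by rewrite (klinear_zmod (lcm_linr mod_M x)) subst_zmod.
  by rewrite w1 [LHS]Rl [in RHS]Rl [LHS](act_atZr mod_M) Ey.
have E2 : ev w (ext (fun v => subst (fun=> var 1) (rho y v))
    (subst (fun=> var 0) (rho x m))) = act_at rho mu y (act_at rho nx x m).
  refine (etrans (@ev_ext1 K 2 M M (fun v => subst (fun=> var 1) (rho y v))
                    0 w nx (rho x m) _ _) (Rm _ _)) => [u v|v].
    by rewrite (klinear_zmod (lcm_linr mod_M y)) subst_zmod.
  by rewrite w0 [LHS]Rm [in RHS]Rm [LHS](act_atZr mod_M) Ex.
have E3 : ev w (ext (fun v => subst (fun=> var 0 + var 1) (rho v m))
    (subst (fun=> var 0) (br x y))) = act_at rho (lam + mu) (act_at br nxy x y) m.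
  refine (etrans (@ev_ext1 K 2 a M (fun v => subst (fun=> var 0 + var 1) (rho v m))
                    0 w nxy (br x y) _ _) (Rlm _ _)) => [u v|v].
    by rewrite (klinear_zmod (lcm_linl mod_M m)) subst_zmod.
  by rewrite w0 [LHS]Rlm [in RHS]Rlm [LHS](act_atZl mod_M) Exy.
have E := congr1 (ev w) (lcm_comm mod_M x y m).
exact (etrans (esym (congr2 (fun u v => u - v) E1 E2))
  (etrans (esym (ev_zmod w _ _)) (etrans E E3))).
Qed.

End Commutator.

Lemma adjoint_module (K : fieldType) (a : lmodType {poly K})
    (br : a -> a -> vpoly 1 a) : is_lca br -> is_lca_module br br.
Proof.
case=> fg ll lr dl dr sk jac; split=> // x y z lam mu.
by apply/eqP; rewrite subr_eq; apply/eqP/jac.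
Qed.

Section Homogeneous.
Variable K : fieldType.
Variables (a M : lmodType {poly K}) (br : a -> a -> vpoly 1 a).
Variable rho : a -> M -> vpoly 1 M.
Hypothesis mod_M : is_lca_module br rho.
Hypothesis mod_a : is_lca_module br br.
Local Notation H := (momentum K * a)%type.
Implicit Types (g : momentum K) (x y z : H) (m : M).

(** When x acts on a vector of momentum g, the arguments add up to g + x.1. *)
Definition hact x g m : M := act_at rho (weight (g + x.1) x.1) x.2 m.

Definition hbr x y : H := (x.1 + y.1, act_at br (weight (x.1 + y.1) x.1) x.2 y.2).

Definition hcomb (c : K) x y z : Prop :=
  [/\ y.1 = x.1, z.1 = x.1 & negligible x.1 (c%:P *: x.2 + y.2 - z.2)].

Lemma hact_negligible x g m : negligible g m -> negligible (g + x.1) (hact x g m).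
Proof.
move=> nm gx1; have [|m' ->] := nm; first exact: leq_trans (leq_addr _ _) gx1.
rewrite /hact (act_atZr mod_M) modulus_comp //.
by exists (act_at rho (weight (g + x.1) x.1) x.2 m').
Qed.

Lemma act_at_negligible t v g m : negligible t v ->
  negligible (g + t) (act_at rho (weight (g + t) t) v m).
Proof.
move=> nv gt1; have [|v' ->] := nv; first exact: leq_trans (leq_addl _ _) gt1.
by rewrite (act_atZl mod_M) modulus_compN // scale0r; exists 0; rewrite scaler0.
Qed.

(** The commutator holds exactly for at most one eliminated argument: by
    [weight_comp] and [weight_compN] the values of the variables at the three
    stages are related as [act_at_comm] requires. *)
Lemma hact_comm x y g m : negligible (g + x.1 + y.1)
  (hact x (g + y.1) (hact y g m) - hact y (g + x.1) (hact x g m)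
   - hact (hbr x y) g m).
Proof.
move=> gxy1; exists 0; rewrite scaler0 /hact /hbr /=.
rewrite (addrAC g y.1 x.1) (addrA g x.1 y.1).
have xy1 : ((x.1 + y.1)%R.2 <= 1)%N.
  by apply: leq_trans gxy1; rewrite -addrA; apply: leq_addl.
have gyx1 : ((g + y.1 + x.1)%R.2 <= 1)%N by rewrite addrAC.
set lam := weight (g + x.1 + y.1) x.1; set mu := weight (g + x.1 + y.1) y.1.
rewrite (act_at_comm mod_M (lam := lam) (mu := mu)
  (nxy := weight (x.1 + y.1) x.1)) ?weightD ?subrr //.
- exact: weight_comp.
- by rewrite /lam /mu addrAC; apply: weight_comp; rewrite addrAC.
by rewrite -weightD // weight_compN.
Qed.

Lemma hcomb_deg c x y z : hcomb c x y z -> y.1 = x.1 /\ z.1 = x.1.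
Proof. by case. Qed.

Lemma hcomb_act c x y z g m : hcomb c x y z ->
  negligible (g + x.1) (c%:P *: hact x g m + hact y g m - hact z g m).
Proof.
case=> dy dz n; have := @act_at_negligible _ _ g m n.
rewrite /hact dy dz (act_at_zmodl mod_M) (zmorphD (act_at_zmodl mod_M _ _)).
by rewrite (act_atZl mod_M) comp_polyC.
Qed.

Lemma hactC x g (c : K) m : hact x g (c%:P *: m) = c%:P *: hact x g m.
Proof. by rewrite /hact (act_atZr mod_M) comp_polyC. Qed.

End Homogeneous.

Arguments hact_negligible {K a M br rho} mod_M x {g m} nm _.
Arguments hact_comm {K a M br rho} mod_M x y g m _.
Arguments hcomb_act {K a M br rho} mod_M {c x y z} g m xyz _.

Section HomogeneousBracket.
Variable K : fieldType.
Variables (a : lmodType {poly K}) (br : a -> a -> vpoly 1 a).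
Hypothesis lca_a : is_lca br.
Local Notation H := (momentum K * a)%type.
Implicit Types (g : momentum K) (x y z w : H).
Let mod_a := adjoint_module lca_a.

Lemma hcomb_brl c x y z w : hcomb c x y z ->
  hcomb c (hbr br x w) (hbr br y w) (hbr br z w).
Proof.
move=> xyz; have [dy dz n] := xyz; split; rewrite /= ?dy ?dz //.
by have := hcomb_act mod_a w.1 w.2 xyz; rewrite /hact dy dz addrC.
Qed.

Lemma hcomb_brr c x y z w : hcomb c x y z ->
  hcomb c (hbr br w x) (hbr br w y) (hbr br w z).
Proof.
case=> dy dz n; split; rewrite /= ?dy ?dz //.
have := hact_negligible mod_a w n; rewrite /hact addrC.
rewrite (act_at_zmodr mod_a) (zmorphD (act_at_zmodr mod_a _ _)).
by rewrite (act_atZr mod_a) comp_polyC.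
Qed.

(** The Jacobi identity is the representation identity of the adjoint module,
    whose vectors carry the momentum z.1. *)
Lemma hcomb_jacobi x y z :
  hcomb 1 (hbr br (hbr br x y) z) (hbr br y (hbr br x z))
    (hbr br x (hbr br y z)).
Proof.
split; rewrite /= ?addrA //; first by rewrite (addrC y.1).
have := negligibleB (negligible0 _ _) (hact_comm mod_a x y z.1 z.2).
rewrite /hact /= polyC1 scale1r -!(addrC z.1) !addrA.
rewrite (addrAC z.1 y.1 x.1) sub0r.
by congr negligible; abel.
Qed.

Lemma act_at_skew (w : {poly K}) (x y : a) :
  act_at br w x y = - act_at br (- w - 'X) y x.
Proof.
rewrite /act_at (lca_skew lca_a) raddfN /= ev_subst; congr (- _).
by apply: eq_ev => i; rewrite peval_NvarBdpar.
Qed.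

(** Skew-symmetry replaces the variable w of x by - w - ∂, which agrees with
    the value of the variable of y modulo the total variable plus ∂. *)
Lemma hcomb_skew x y : exists2 o,
  hcomb 1 (hbr br x y) (hbr br y x) o & hcomb 1 o o o.
Proof.
exists (x.1 + y.1, 0); last first.
  by split=> //; rewrite /= scaler0 addr0 subr0; apply: negligible0.
split; rewrite /= ?(addrC y.1) // polyC1 scale1r subr0 => xy1.
set t := x.1 + y.1; rewrite act_at_skew addrC.
apply: ev_congr => _; exists 1; rewrite mulr1 -(weight_self xy1).
by rewrite weightD //; ring.
Qed.

Definition kscale (N : lmodType {poly K}) (c : K) (v : N) : N := c%:P *: v.

Lemma homogeneous_graded_lie (M : lmodType {poly K})
    (rho : a -> M -> vpoly 1 M) :
    is_lca_module br rho ->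
  graded_lie (@kscale M) fst (hbr br) (hact rho) (@negligible K M) (@hcomb K a).
Proof.
move=> mod_M; split.
- exact: negligible0.
- exact: @negligibleB.
- by move=> c u v; rewrite /kscale scalerBr.
- by move=> v; rewrite /kscale polyC1 scale1r.
- by [].
- by move=> x g; apply: (act_at_zmodr mod_M).
- by move=> x g c v; apply: (hactC mod_M).
- by move=> x g v nv; apply: (hact_negligible mod_M x nv).
- exact: (hact_comm mod_M).
- exact: hcomb_deg.
- by move=> c x y z g v; apply: (hcomb_act mod_M).
- exact: hcomb_brl.
- exact: hcomb_brr.
- exact: hcomb_jacobi.
- exact: hcomb_skew.
Qed.

End HomogeneousBracket.

Arguments kscale {K} N c v.

(** * Cochains as functions of lists *)

Section Dagger.
Variable K : fieldType.

(** Completes the values of the first variables so that all of them add up to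
    minus the derivation; the value of [dagger] at w. *)
Definition close n (w : 'I_n -> {poly K}) (i : 'I_n.+1) : {poly K} :=
  if unlift ord_max i is Some j then w j else - (\sum_j w j) - 'X.

Lemma peval_dagger n (w : 'I_n -> {poly K}) i : peval w (dagger i) = close w i.
Proof.
rewrite /dagger /close; case: unlift => [j|]; first exact: peval_var.
apply: etrans (pevalD _ _ _) (congr2 +%R _ _); last first.
  exact (etrans (pevalN _ _) (congr1 -%R (peval_dpar w))).
apply: (etrans (pevalN _ _)); rewrite peval_sum; congr (- _).
by apply: eq_bigr => i0 _; apply: peval_var.
Qed.

Lemma widen_lift n (j : 'I_n) : widen_ord (leqnSn n) j = lift ord_max j.
Proof. by apply: val_inj; rewrite /= /bump leqNgt ltn_ord. Qed.

Lemma close_widen n (w : 'I_n -> {poly K}) j :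
  close w (widen_ord (leqnSn n) j) = w j.
Proof.
by rewrite widen_lift /close liftK.
Qed.

Lemma close_max n (w : 'I_n -> {poly K}) :
  close w ord_max = - (\sum_j w j) - 'X.
Proof. by rewrite /close unlift_none. Qed.

Lemma ev_dag n (N : lmodType {poly K}) (w : 'I_n -> {poly K})
    (u : vpoly n.+1 N) : ev w (dag u) = ev (close w) u.
Proof.
by rewrite /dag ev_subst; apply: eq_ev => i; rewrite peval_dagger.
Qed.

Lemma ev_fapp n q (M N : lmodType {poly K}) (f : kmap n M N) (s : 'I_n.+1 -> 'I_q)
    (w : 'I_q -> {poly K}) x :
  ev w (fapp f (fun i => var (s i)) x) =
  ev (fun i => w (s (widen_ord (leqnSn n) i))) (f x).
Proof. by rewrite /fapp ev_subst; apply: eq_ev => i; rewrite peval_var. Qed.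

End Dagger.

Lemma fset_at_at n T (x : {ffun 'I_n -> T}) i u v :
  fset_at (fset_at x i u) i v = fset_at x i v.
Proof. by apply/ffunP => j; rewrite !ffunE; case: eqP. Qed.

Lemma fset_at_id n T (x : {ffun 'I_n -> T}) i : fset_at x i (x i) = x.
Proof. by apply/ffunP => j; rewrite !ffunE; case: eqP => [->|]. Qed.

Lemma fset_atE n T (x : {ffun 'I_n -> T}) i v : fset_at x i v i = v.
Proof. by rewrite ffunE eqxx. Qed.

Lemma nth_swap (T : Type) (x0 : T) s1 s2 x y n (i j l : 'I_n) :
    val i = size s1 -> val j = (size s1).+1 ->
  nth x0 (s1 ++ y :: x :: s2) l = nth x0 (s1 ++ x :: y :: s2) (tperm i j l).
Proof.
move=> vi vj; case: tpermP => [->|->|/eqP + /eqP +].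
- by rewrite vi vj !nth_cat ltnn subnn ltnNge leqnSn subSnn.
- by rewrite vi vj !nth_cat ltnn subnn ltnNge leqnSn subSnn.
rewrite -!val_eqE /= vi vj !nth_cat; case: (ltngtP l (size s1)) => // gt _ neq.
by rewrite -(subnSK gt) /=; case E: (l - _)%N neq => [|d] //=; lia.
Qed.

Section ListCochain.
Variable K : fieldType.
Variables (a M : lmodType {poly K}).
Local Notation H := (momentum K * a)%type.
Local Notation h0 := ((0, 0) : H).
Implicit Types (s : seq H) (t : momentum K).

Definition net_momentum s : momentum K := mom fst 0 s.

Lemma netE s : net_momentum s = \sum_(h <- s) h.1.
Proof. by rewrite /net_momentum momE add0r. Qed.

Lemma net_del s i : (i < size s)%N ->
  net_momentum s = net_momentum (del i s) + (nth h0 s i).1.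
Proof.
move=> ltis; rewrite /net_momentum (mom_del fst h0 0 ltis) !momE add0r [RHS]addrC.
by rewrite add0r.
Qed.

Lemma weight_sum t s : ((net_momentum s).2 <= 1)%N ->
  \sum_(h <- s) weight t h.1 = weight t (net_momentum s).
Proof.
rewrite netE; elim: s => [|h s IH]; first by rewrite !big_nil.
rewrite !big_cons => le1; rewrite IH ?weightD //.
by apply: leq_trans le1; apply: leq_addl.
Qed.

Definition weights s i : {poly K} := weight (net_momentum s) (nth h0 s i).1.

(** Eliminating the last variable is compatible with [weights], whichever
    argument is the eliminated one: the [weights] of a list already add up to
    - ∂, or, if nothing is eliminated in it, do so modulo its modulus. *)
Lemma close_weights n s (i : 'I_n.+1) :
    size s = n.+1 -> ((net_momentum s).2 <= 1)%N ->
  exists e, close (fun j : 'I_n => weights s j) i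
    = weights s i + modulus (net_momentum s) * e.
Proof.
move=> sz le1.
have [j ->|->] := unliftP ord_max i.
  by exists 0; rewrite mulr0 addr0 -widen_lift close_widen.
(* The last value is off by the total of the values plus ∂, the modulus. *)
exists (-1); rewrite close_max mulrN1 -(weight_self le1).
have := weight_sum (net_momentum s) le1.
rewrite (big_nth h0) sz big_mkord big_ord_recr /= => E.
rewrite -E /weights; ring.
Qed.

(** The value of f at arguments with momenta.  Lists of a wrong length get the
    value 0, which makes [respects] and [alternating] hold for lists of every
    length. *)
Definition kmap_at n (f : kmap n a M) s : M :=
  if size s == n.+1 then
    ev (fun i : 'I_n => weights s i) (f [ffun i : 'I_n.+1 => (nth h0 s i).2])
  else 0.

Lemma kmap_atE n (f : kmap n a M) s : size s = n.+1 -> kmap_at f s =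
  ev (fun i : 'I_n => weights s i) (f [ffun i : 'I_n.+1 => (nth h0 s i).2]).
Proof. by move=> sz; rewrite /kmap_at sz eqxx. Qed.

(** The values of the variables depend on momenta only, so a cochain at a list
    is, as a function of one entry, that cochain evaluated at a fixed point. *)
Lemma kmap_at_entry n (f : kmap n a M) s1 s2 t : (size s1 + size s2 = n)%N ->
  exists (X : {ffun 'I_n.+1 -> a}) i w, [/\ val i = size s1,
    forall v, kmap_at f (s1 ++ (t, v) :: s2) = ev w (f (fset_at X i v)) &
    forall v, w =1 (fun j => weights (s1 ++ (t, v) :: s2) j)].
Proof.
move=> sz.
have lti : (size s1 < n.+1)%N by rewrite ltnS -sz leq_addr.
exists [ffun i : 'I_n.+1 => (nth h0 (s1 ++ (t, 0) :: s2) i).2], (Ordinal lti).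
exists (fun j => weights (s1 ++ (t, 0) :: s2) j).
have W v j : weights (s1 ++ (t, 0) :: s2) j = weights (s1 ++ (t, v) :: s2) j.
  rewrite /weights !netE !big_cat !big_cons /=; congr weight.
  by rewrite !nth_cat; case: ifP => // _; case: (_ - _)%N.
split=> [//|v|v j]; last exact: W.
rewrite kmap_atE; last by rewrite size_cat /= addnS sz.
rewrite (eq_ev (w' := fun j : 'I_n => weights (s1 ++ (t, 0) :: s2) j));
  last by move=> j; rewrite -W.
congr (ev _ (f _)); apply/ffunP => j; rewrite !ffunE -val_eqE /= !nth_cat.
case: ltngtP => [lt|gt|->]; rewrite ?subnn //.
by rewrite -(subnSK gt).
Qed.

(** Conformal sesquilinearity of all the arguments, the last one included, in
    one formula: [close w i] is the value of the variable of the i-th one. *)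
Lemma ev_cochainZ n (f : kmap n a M) (w : 'I_n -> {poly K}) x i q v :
    is_cochain f ->
  ev w (f (fset_at x i (q *: v))) =
  (q \Po (- close w i)) *: ev w (f (fset_at x i v)).
Proof.
move=> fc; have fl := cochain_lin fc x i.
elim/poly_ind: q v => [|q c IH] v.
  by rewrite comp_poly0 !scale0r (zmorph0 (klinear_zmod fl)) raddf0.
rewrite comp_polyD comp_polyM comp_polyX comp_polyC !scalerDl.
rewrite (zmorphD (klinear_zmod fl)) raddfD -!scalerA /= IH; congr (_ + _).
  apply: (congr1 (fun z => _ *: z)).
  have := cochain_d fc (fset_at x i v) i; rewrite fset_at_at fset_atE => ->.
  rewrite evZ; congr (_ *: _).
  exact (etrans (pevalN _ _) (congr1 -%R (peval_dagger _ _))).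
by rewrite (klinearZ fl) evZ peval_malgC.
Qed.

Lemma fapp_fcons_zmod n q (f : kmap n a M)
    (w : 'I_n.+1 -> {mpoly {poly K}[q]}) (y : nat -> a) :
  is_cochain f -> zmod_morphism (fun c => fapp f w [ffun t => fcons c y t]).
Proof.
move=> fc; pose X : {ffun 'I_n.+1 -> a} := [ffun t => fcons 0 y t].
have XE c : [ffun t : 'I_n.+1 => fcons c y t] = fset_at X ord0 c.
  by apply/ffunP => -[[|l] ltl]; rewrite !ffunE.
move=> u v; rewrite !XE /fapp.
by rewrite (klinear_zmod (cochain_lin fc X ord0)) subst_zmod.
Qed.

(** Linearity over C comes from [cochain_lin].  A negligible entry is a multiple
    of ∂ + p where p is the value of its own variable, and sesquilinearity
    turns ∂ + p into p - p = 0, up to the modulus of the list. *)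
Lemma kmap_at_respects n (f : kmap n a M) : is_cochain f ->
  respects (kscale M) fst (@negligible K M) (@hcomb K a) 0 (kmap_at f).
Proof.
move=> fc s1 s2 c [t x] [t1 y] [t2 z] [/= -> -> {t1 t2} nv].
have [sz|sz] := eqVneq (size s1 + size s2)%N n; last first.
  rewrite /kmap_at !size_cat /= addnS eqSS (negPf sz) /kscale.
  by rewrite scaler0 addr0 subr0; apply: negligible0.
have [X [i [w [vali FE wE]]]] := kmap_at_entry f t sz.
have fl := cochain_lin fc X i.
have fB := klinear_zmod fl.
rewrite !FE /kscale.
have -> : c%:P *: ev w (f (fset_at X i x)) = ev w (f (fset_at X i (c%:P *: x))).
  by rewrite (klinearZ fl) evZ peval_malgC.
rewrite -raddfD -raddfB /= -(zmorphD fB) -fB.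
move: (_ + _ - _) nv => v nv.
set s := s1 ++ _; rewrite -/(net_momentum s) => le1.
have szs : size s = n.+1 by rewrite size_cat /= addnS sz.
have nthi : nth h0 s i = (t, x) by rewrite vali nth_cat ltnn subnn.
have lti : (i < size s)%N by rewrite szs.
have Etot := net_del lti; rewrite nthi /= in Etot.
have [|v' ->] := nv.
  by apply: leq_trans le1; rewrite Etot leq_addl.
rewrite (ev_cochainZ _ _ _ _ _ fc).
have [e Ee] := close_weights i szs le1.
have -> : close w i = weights s i + modulus (net_momentum s) * e.
  rewrite -Ee /close; case: unlift => [j|]; first exact: wE.
  by congr (- _ - _); apply: eq_bigr => j _; apply: wE.
suff [e' ->] : exists e',
    modulus t \Po (- (weights s i + modulus (net_momentum s) * e))
    = modulus (net_momentum s) * e'.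
  by exists (e' *: ev w (f (fset_at X i v'))); rewrite scalerA.
have := @modulus_compN K (net_momentum (del i s)) t; rewrite -Etot => /(_ le1).
rewrite /weights nthi /= /modulus; case: (t.2 == 0%N) => E; last first.
  by exists 0; rewrite comp_poly0 mulr0.
exists (- e); move: E; rewrite !comp_polyD !comp_polyX !comp_polyC => E.
by rewrite opprD addrAC E add0r mulrN.
Qed.

(** Skew-symmetry permutes the variables along with the arguments and
    eliminates the last one; by [close_weights] the elimination does not
    change the value, modulo the modulus. *)
Lemma kmap_at_alternating n (f : kmap n a M) : is_cochain f ->
  alternating fst (@negligible K M) 0 (kmap_at f).
Proof.
move=> fc s1 s2 x y; rewrite -/(net_momentum _).
set s := s1 ++ _; set s' := s1 ++ _.
have [sz|sz] := eqVneq (size s) n.+1; last first.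
  have sz' : size s' = size s by rewrite !size_cat.
  by rewrite /kmap_at sz' (negPf sz) addr0; apply: negligible0.
move=> le1.
have sz' : size s' = n.+1 by rewrite -sz !size_cat.
have tot : net_momentum s' = net_momentum s.
  rewrite !netE !big_cat !big_cons /=; congr (_ + _).
  by rewrite addrCA.
have lti : (size s1 < n.+1)%N by rewrite -sz size_cat /= addnS ltnS leq_addr.
have ltj : ((size s1).+1 < n.+1)%N by rewrite -sz size_cat /= !addnS !ltnS leq_addr.
pose i := Ordinal lti; pose j := Ordinal ltj; pose p := tperm i j.
have nthp (l : 'I_n.+1) : nth h0 s' l = nth h0 s (p l) by apply: nth_swap.
rewrite (kmap_atE f sz) (kmap_atE f sz').
set X := [ffun _ => _]; set X' := [ffun _ => _].
have -> : X' = [ffun l => X (p l)] by apply/ffunP => l; rewrite !ffunE nthp.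
rewrite [in f X](cochain_skew fc p X) evZ odd_tperm.
have -> : (i != j) = true by rewrite -val_eqE /= neq_ltn leqnn.
rewrite expr1 pevalN (_ : peval _ 1 = 1); last exact: rmorph1.
rewrite scaleN1r ev_dag ev_fapp addrC.
apply: ev_congr => l.
have [e ->] := close_weights (p (widen_ord (leqnSn n) l)) sz le1.
exists (- e); rewrite /weights tot -nthp /=; ring.
Qed.

End ListCochain.

(** * The Chevalley-Eilenberg formula at homogeneous elements *)

Lemma size_del (T : Type) i (s : seq T) : (i < size s)%N ->
  size (del i s) = (size s).-1.
Proof.
by move=> lti; rewrite size_cat size_take size_drop lti; lia.
Qed.

Lemma nth_del (T : Type) (x0 : T) i (s : seq T) t : (i < size s)%N ->
  nth x0 (del i s) t = nth x0 s (bump i t).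
Proof.
move=> lti; rewrite nth_cat size_take lti /bump.
have [le|lt] := leqP i t; last by rewrite nth_take.
by rewrite nth_drop; congr nth; lia.
Qed.

Section Bridge.
Variable K : fieldType.
Variables (a M : lmodType {poly K}) (br : a -> a -> vpoly 1 a).
Variable rho : a -> M -> vpoly 1 M.
Hypothesis mod_M : is_lca_module br rho.
Local Notation H := (momentum K * a)%type.
Local Notation h0 := ((0, 0) : H).
Implicit Types (s : seq H).

Lemma ev_sgn n (N : lmodType {poly K}) (w : 'I_n -> {poly K}) k (u : vpoly n N) :
  ev w ((-1) ^+ k *: u) = neg_if (odd k) (ev w u).
Proof.
rewrite -signr_odd; case: (odd k); rewrite /= ?expr1 ?expr0.
  by rewrite scaleN1r raddfN.
by rewrite scale1r.
Qed.

(** rho(x_i) f(...) is computed before x_i joins the arguments, at the values of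
    the variables in [del i s]; [weight_comp] is the semilinearity that
    [ev_ext] asks for. *)
Lemma ev_action_term n (f : kmap n a M) s (x : 'I_n.+2 -> a) (i : 'I_n.+2) :
    (forall k, x k = (nth h0 s k).2) ->
    size s = n.+2 -> ((net_momentum s).2 <= 1)%N ->
  ev (fun k : 'I_n.+2 => weights s k)
    (ext (fun m => subst (fun=> var i) (rho (x i) m))
       (fapp f (fun t => var (lift i t)) [ffun t => x (lift i t)])) =
  hact rho (nth h0 s i) (net_momentum (del i s)) (kmap_at f (del i s)).
Proof.
move=> /boolp.funext-> sz le1; have lti : (i < size s)%N by rewrite sz.
have szd : size (del i s) = n.+1 by rewrite size_del // sz.
have Etot := net_del lti.
set w := fun k : 'I_n.+2 => weights s k.
have Rw m : ev w (subst (fun=> var i) (rho (nth h0 s i).2 m))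
    = act_at rho (weight (net_momentum (del i s) + (nth h0 s i).1) (nth h0 s i).1)
             (nth h0 s i).2 m.
  by rewrite ev_subst -Etot; apply: eq_ev => k; rewrite peval_var.
refine (etrans (@ev_ext K n n.+2 M M _ (fun l => lift i (widen_ord (leqnSn n) l))
  w (fun l => weights (del i s) l) _ _ _) _) => [u v|l m|].
- by rewrite (klinear_zmod (lcm_linr mod_M _)) subst_zmod.
- rewrite [LHS]Rw [in RHS]Rw [LHS](act_atZr mod_M); congr (_ *: _).
  have ltl : (l < size (del i s))%N by rewrite szd ltnS ltnW.
  have Ed := net_del ltl.
  have := @weight_comp K (net_momentum (del l (del i s))) (nth h0 s i).1
    (nth h0 (del i s) l).1.
  by rewrite addrAC -Ed -Etot /w /weights nth_del // => /(_ le1).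
rewrite [LHS]Rw /hact (kmap_atE _ szd); congr act_at; congr (ev _ (f _)).
by apply/ffunP => l; rewrite !ffunE nth_del.
Qed.

(** Inside {x_i x_j} the variable of x_i takes the value it has when x_i and x_j
    are the only arguments.  By sesquilinearity of f and [weight_compN] this
    becomes its value in s; a scalar variable does not change. *)
Lemma ev_bracket_term n (f : kmap n a M) s (x : 'I_n.+2 -> a) (i j : 'I_n.+2) :
    (forall k, x k = (nth h0 s k).2) ->
    is_cochain f -> size s = n.+2 -> ((net_momentum s).2 <= 1)%N -> (i < j)%N ->
  ev (fun k : 'I_n.+2 => weights s k)
    (let skip t : 'I_n.+2 := inord (bump j (bump i t)) in
     ext (fun c => fapp f (fcons (var i + var j) (fun t => var (skip t)))
              [ffun t => fcons c (fun t' => x (skip t')) t])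
       (subst (fun=> var i) (br (x i) (x j)))) =
  kmap_at f (hbr br (nth h0 s i) (nth h0 s j) :: del i (del j s)).
Proof.
move=> /boolp.funext-> fc sz le1 ltij; set hi := nth h0 s i; set hj := nth h0 s j.
have ltj : (j < size s)%N by rewrite sz.
have szj : size (del j s) = n.+1 by rewrite size_del // sz.
have lti : (i < size (del j s))%N by rewrite szj; have := ltn_ord j; lia.
have szij : size (del i (del j s)) = n by rewrite size_del // szj.
have nthi : nth h0 (del j s) i = hi.
  by rewrite nth_del // /bump leqNgt ltij.
have Etot : net_momentum s = net_momentum (del i (del j s)) + hi.1 + hj.1.
  by rewrite (net_del ltj) (net_del lti) nthi.
set w := fun k : 'I_n.+2 => weights s k.
set skip := fun t : nat => _.
have nths l : (l < n)%N -> nth h0 s (skip l) = nth h0 (del i (del j s)) l.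
  move=> ltl; rewrite /skip inordK; first by rewrite !nth_del.
  by rewrite /bump; lia.
pose L c := (hi.1 + hj.1, c) :: del i (del j s).
have totL c : net_momentum (L c) = net_momentum s.
  by rewrite netE big_cons -netE Etot /= -[RHS]addrA addrC.
have szL c : size (L c) = n.+1 by rewrite /= szij.
have le1' : ((hi.1 + hj.1)%R.2 <= 1)%N.
  by apply: leq_trans le1; rewrite Etot -addrA leq_addl.
have weightsL c (l : 'I_n.+1) : weights (L c) l =
    fcons (w i + w j) (fun t => w (skip t)) l.
  rewrite /weights totL /fcons; case: l => [[|l] ltl] /=.
    by rewrite weightD.
  by rewrite /w /weights nths.
have FE c : ev w (fapp f (fcons (var i + var j) (fun t => var (skip t)))
      [ffun t => fcons c (fun t' => (nth h0 s (skip t')).2) t]) = kmap_at f (L c).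
  rewrite (kmap_atE _ (szL c)) /fapp ev_subst.
  rewrite (eq_ev (w' := fun l : 'I_n => weights (L c) l)) => [|l]; last first.
    rewrite (weightsL c (widen_ord (leqnSn n) l)) /fcons /=.
    by case: (val l) => [|l']; [apply: peval_varDvar|apply: peval_var].
  congr (ev _ (f _)); apply/ffunP => l; rewrite !ffunE /fcons.
  by case: l => [[|l] ltl] //=; rewrite nths.
have hB := fapp_fcons_zmod (fcons (var i + var j) (fun t => var (skip t)))
  (fun t' => (nth h0 s (skip t')).2) fc.
refine (etrans (@ev_ext1 K n.+2 a M _ i w (weight (hi.1 + hj.1) hi.1) _ hB _) _).
  move=> c; rewrite [LHS]FE [in RHS]FE.
  have [X [k [w' [k0 FX wX]]]] :=
    @kmap_at_entry K a M n f [::] _ (hi.1 + hj.1) szij.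
  rewrite !(FX _ : kmap_at f (L _) = _) (ev_cochainZ _ _ _ _ _ fc).
  congr (_ *: _).
  have [hi0|hi0] := eqVneq hi.1.2 0%N.
    by rewrite /w /weights /weight -/hi hi0 comp_polyC.
  have sz1 : size (L c) = n.+1 := szL c.
  have le2 : ((net_momentum (L c)).2 <= 1)%N by rewrite totL.
  have [e] := close_weights k sz1 le2.
  (* x_i is the eliminated argument here, so that the closed value is exact. *)
  have mod0 : modulus (net_momentum s) = 0.
    have : (0 < (net_momentum s).2)%N.
      rewrite Etot; set r := net_momentum (del i (del j s)).
      by change (0 < r.2 + hi.1.2 + hj.1.2)%N; lia.
    by rewrite /modulus; case: eqP => // ->.
  rewrite totL mod0 mul0r addr0 /weights totL k0 /= => Ec.
  have -> : close w' k = weight (net_momentum s) (hi.1 + hj.1).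
    have wL l : w' l = weight (net_momentum s) (nth h0 (L c) l).1.
      by rewrite (wX c) /weights (totL c : net_momentum ([::] ++ _) = _).
    rewrite -Ec /close; case: unlift => [l|]; first exact: wL.
    by congr (- _ - _); apply: eq_bigr => l _; apply: wL.
  have := @weight_compN K (net_momentum (del i (del j s))) hi.1 hj.1.
  by rewrite -Etot => /(_ le1).
by rewrite [LHS]FE.
Qed.

(** Both sides are values of one polynomial, the differential before its last
    variable is eliminated: on the left the last value is completed from the
    others, on the right all of them are [weights s]. *)
Lemma kmap_at_ce_d n (f : kmap n a M) s : is_cochain f -> size s = n.+2 ->
  negligible (net_momentum s) (kmap_at (ce_d br rho f) s
    - ce_sum fst (hbr br) (hact rho) h0 0 (kmap_at f) s).
Proof.
move=> fc sz le1; rewrite (kmap_atE _ sz) /ce_d ev_dag.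
set Phi := (X in ev _ X).
have -> : ce_sum fst (hbr br) (hact rho) h0 0 (kmap_at f) s =
    ev (fun k : 'I_n.+2 => weights s k) Phi.
  rewrite /ce_sum /Phi raddfD !raddf_sum sz /=; congr (_ + _).
    apply: eq_bigr => i _; rewrite [RHS]ev_sgn; congr neg_if; apply: esym.
    by apply: ev_action_term => // k; rewrite ffunE.
  apply: eq_bigr => i _; rewrite raddf_sum; apply: eq_bigr => j ltij.
  rewrite [RHS]ev_sgn; congr neg_if; apply: esym.
  by apply: (ev_bracket_term (x := [ffun _ => _])) => // k; rewrite ffunE.
apply: ev_congr => k; have [e ->] := close_weights k sz le1.
by exists e.
Qed.

End Bridge.

(** * The differential is a cochain and squares to zero *)

(** Transpositions generate, and conjugation by adjacent ones brings the entries
    of a transposition next to each other. *)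
Lemma perm_adjacent_ind n (Q : 'S_n.+1 -> Prop) :
    Q 1%g -> (forall s t, Q s -> Q t -> Q (s * t)%g) ->
    (forall i j : 'I_n.+1, j = i.+1 :> nat -> Q (tperm i j)) ->
  forall s, Q s.
Proof.
move=> Q1 QM Qadj s.
have Qlt d : forall i j : 'I_n.+1, j = (i + d.+1)%N :> nat -> Q (tperm i j).
  elim: d => [|d IH] i j ij; first by apply: Qadj; rewrite ij addn1.
  have ltk : (i + d.+1 < n.+1)%N by have := ltn_ord j; lia.
  pose k := Ordinal ltk.
  have ik : i != k by rewrite -val_eqE /=; lia.
  have jk : j != k by rewrite -val_eqE /=; lia.
  have ji : i != j by rewrite -val_eqE /=; lia.
  have -> : tperm i j = (tperm i k ^ tperm k j)%g.
    by rewrite tpermJ tpermL tpermD // eq_sym.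
  rewrite conjgE tpermV.
  have Qkj : Q (tperm k j) by apply: Qadj; rewrite /=; lia.
  by do !apply: (QM) => //; apply: IH.
have [ts -> _] := prod_tpermP s.
elim/big_ind: _ => // -[i j] _ /=.
case: (ltngtP i j) => [lt|lt|/val_inj->].
- by apply: (Qlt (j - i).-1); lia.
- by rewrite tpermC; apply: (Qlt (i - j).-1); lia.
by rewrite tperm1.
Qed.

Section Lists.
Variable K : fieldType.
Variables (a M : lmodType {poly K}).
Local Notation H := (momentum K * a)%type.
Local Notation h0 := ((0, 0) : H).

Definition ord_seq n (y : 'I_n.+1 -> H) : seq H := [seq y i | i <- enum 'I_n.+1].

Lemma size_ord_seq n (y : 'I_n.+1 -> H) : size (ord_seq y) = n.+1.
Proof. by rewrite size_map size_enum_ord. Qed.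

Lemma nth_ord_seq n (y : 'I_n.+1 -> H) (i : 'I_n.+1) : nth h0 (ord_seq y) i = y i.
Proof. by rewrite (nth_map i) ?size_enum_ord // nth_ord_enum. Qed.

Lemma net_ord_seq n (y : 'I_n.+1 -> H) : net_momentum (ord_seq y) = \sum_i (y i).1.
Proof. by rewrite netE big_map big_enum. Qed.

(** The scalar values p for the first variables, the last one eliminated; the
    total momentum then has k = 1, where congruences are equalities. *)
Definition point n (p : 'I_n -> K) (i : 'I_n.+1) : momentum K :=
  if unlift ord_max i is Some j then (p j, 0%N) else (0, 1%N).

Lemma net_point n (p : 'I_n -> K) (x : 'I_n.+1 -> a) :
  (net_momentum (ord_seq (fun i => (point p i, x i)))).2 = 1%N.
Proof.
rewrite net_ord_seq big_ord_recr /= /point unlift_none.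
rewrite (eq_bigr (fun i => (p i, 0%N))) => [|i _]; last first.
  by rewrite widen_lift liftK.
suff -> : (\sum_i ((p i, 0%N) : momentum K)).2 = 0%N by [].
by elim/big_rec: _ => // i q _ /= ->.
Qed.

Lemma kmap_at_point n (f : kmap n a M) p (x : {ffun 'I_n.+1 -> a}) :
  kmap_at f (ord_seq (fun i => (point p i, x i))) = ev (fun i => (p i)%:P) (f x).
Proof.
rewrite (kmap_atE _ (size_ord_seq _)).
rewrite (eq_ev (w' := fun i => (p i)%:P)) => [|i]; last first.
  rewrite /weights (nth_ord_seq _ (widen_ord (leqnSn n) i)) /= /point.
  by rewrite widen_lift liftK.
by congr (ev _ (f _)); apply/ffunP => i; rewrite ffunE nth_ord_seq.
Qed.

Lemma ord_seq_fset_at n (t : 'I_n.+1 -> momentum K) (x : {ffun 'I_n.+1 -> a}) i :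
  exists s1 s2, forall v,
    ord_seq (fun j => (t j, fset_at x i v j)) = s1 ++ (t i, v) :: s2.
Proof.
pose L := ord_seq (fun j => (t j, x j)).
exists (take i L), (drop i.+1 L) => v.
have lti : (i < size L)%N by rewrite size_ord_seq.
apply: (eq_from_nth (x0 := h0)) => [|j].
  rewrite size_cat /= size_take size_drop lti !size_ord_seq.
  by have := ltn_ord i; lia.
rewrite size_ord_seq => ltj.
rewrite (nth_ord_seq _ (Ordinal ltj)) ffunE -val_eqE /=.
rewrite nth_cat size_take lti; case: ltngtP => [lt|gt|E].
- by rewrite nth_take // (nth_ord_seq _ (Ordinal ltj)).
- rewrite -(subnSK gt) /= nth_drop subnKC //.
  by rewrite (nth_ord_seq _ (Ordinal ltj)).
by rewrite -E subnn /=; congr (t _, _); apply: val_inj.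
Qed.

End Lists.

Section Differential.
Variable K : numFieldType.
Variables (a M : lmodType {poly K}) (br : a -> a -> vpoly 1 a).
Variable rho : a -> M -> vpoly 1 M.
Hypothesis lca_a : is_lca br.
Hypothesis mod_M : is_lca_module br rho.
Local Notation H := (momentum K * a)%type.
Local Notation h0 := ((0, 0) : H).
Local Notation cD := (cartanD fst (hbr br) (hact rho) 0).
Let gl := homogeneous_graded_lie lca_a mod_M.

Lemma kmap_at_ce_d_cartanD n (f : kmap n a M) : is_cochain f ->
  vanishes fst (@negligible K M) n.+2 0
    (fun s => kmap_at (ce_d br rho f) s - cD (kmap_at f) s).
Proof.
move=> fc s sz.
have E := kmap_at_ce_d mod_M fc sz.
have E' := ce_sumE gl h0 s (kmap_at_alternating fc).
by apply: (Zeq _ (ZD gl E E')); abel.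
Qed.

(** At total momentum (p, 1) being negligible is being zero. *)
Lemma kmap_at_ce_d_full n (f : kmap n a M) (s : seq H) : is_cochain f ->
  size s = n.+2 -> (net_momentum s).2 = 1%N ->
  kmap_at (ce_d br rho f) s = cD (kmap_at f) s.
Proof.
move=> fc sz t1; apply: subr0_eq.
exact: negligible_full t1 (kmap_at_ce_d_cartanD fc sz).
Qed.

Lemma ce_d_linear n (f : kmap n a M) x i : is_cochain f ->
  klinear (fun v => ce_d br rho f (fset_at x i v)).
Proof.
move=> fc c u v; apply: ev_inj => p; rewrite (zmorphD (ev_zmod _)) evZ peval_malgC.
have [s1 [s2 E]] := ord_seq_fset_at (point p) x i.
have F w : ev (fun k => (p k)%:P) (ce_d br rho f (fset_at x i w)) =
    cD (kmap_at f) (s1 ++ (point p i, w) :: s2).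
  by rewrite -kmap_at_point kmap_at_ce_d_full ?size_ord_seq ?net_point // E.
rewrite [LHS](F (c%:P *: u + v)) [X in _ = _ *: X + _](F u) [X in _ = _ + X](F v).
apply: esym; apply: subr0_eq.
have := cartanD_respects gl (kmap_at_respects fc) s1 s2
  (x := (point p i, u)) (y := (point p i, v))
  (z := (point p i, c%:P *: u + v)) (c := c).
move=> R; apply: (negligible_full (g := mom fst 0 (s1 ++ (point p i, u) :: s2))).
  by rewrite -/(net_momentum _) -E net_point.
by apply: R; split=> //=; rewrite subrr; apply: negligible0.
Qed.

(** An element of momentum (p, 0) is multiplied by - p when the derivation is
    applied to it, up to negligible ones; so sesquilinearity in a scalar
    argument is a case of multilinearity. *)
Lemma ce_d_sesquilinear n (f : kmap n a M) x (j : 'I_n.+1) : is_cochain f ->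
  ce_d br rho f (fset_at x (lift ord_max j) ('X *: x (lift ord_max j))) =
  - dagger (lift ord_max j) *: ce_d br rho f x.
Proof.
move=> fc; set i := lift ord_max j; apply: ev_inj => p.
have [s1 [s2 E]] := ord_seq_fset_at (point p) x i.
have F w : ev (fun k => (p k)%:P) (ce_d br rho f (fset_at x i w)) =
    cD (kmap_at f) (s1 ++ (point p i, w) :: s2).
  by rewrite -kmap_at_point kmap_at_ce_d_full ?size_ord_seq ?net_point // E.
rewrite evZ (_ : peval _ _ = - (p j)%:P); last first.
  by rewrite /dagger liftK peval_Nvar.
have -> : ce_d br rho f x = ce_d br rho f (fset_at x i (x i)).
  by rewrite fset_at_id.
have F0 : cD (kmap_at f) (s1 ++ (point p i, 0) :: s2) = 0.
  by rewrite -F (zmorph0 (klinear_zmod (ce_d_linear x i fc))) raddf0.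
rewrite [LHS](F ('X *: x i)) [X in _ = _ *: X](F (x i)).
apply: esym; apply: subr0_eq.
have R := cartanD_respects gl (kmap_at_respects fc) s1 s2
  (x := (point p i, x i)) (y := (point p i, 0))
  (z := (point p i, 'X *: x i)) (c := - p j).
apply: (negligible_full (g := mom fst 0 (s1 ++ (point p i, x i) :: s2))).
  by rewrite -/(net_momentum _) -E net_point.
have := R; rewrite F0 addr0 /kscale polyCN; apply.
split=> //= _; exists (- x i); rewrite /point /modulus liftK /=.
by rewrite polyCN addr0 scalerN scalerDl opprD scaleNr addrC.
Qed.

(** Alternation, from adjacent transpositions to all permutations. *)
Lemma ce_d_perm n (f : kmap n a M) (s : 'S_n.+2) : is_cochain f ->
  forall y : 'I_n.+2 -> H, (net_momentum (ord_seq y)).2 = 1%N ->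
    kmap_at (ce_d br rho f) (ord_seq (fun i => y (s i))) =
    neg_if s (kmap_at (ce_d br rho f) (ord_seq y)).
Proof.
move=> fc.
have totp (t : 'S_n.+2) (y : 'I_n.+2 -> H) :
    net_momentum (ord_seq (fun i => y (t i))) = net_momentum (ord_seq y).
  by rewrite !net_ord_seq [RHS](reindex_inj (@perm_inj _ t)).
elim/perm_adjacent_ind: s => [|s t IHs IHt|i j ij] y y1.
- by rewrite odd_perm1; congr kmap_at; apply: eq_map => i; rewrite perm1.
- rewrite odd_permM; have := IHs (fun i => y (t i)).
  rewrite totp IHt // => /(_ y1) E.
  have -> : ord_seq (fun i => y ((s * t)%g i)) = ord_seq (fun i => y (t (s i))).
    by apply: eq_map => i; rewrite permM.
  by rewrite E; case: (odd_perm s); case: (odd_perm t); rewrite /= ?opprK.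
set L := ord_seq y; pose s1 := take i L; pose s2 := drop j.+1 L.
have szL : size L = n.+2 := size_ord_seq y.
have lti : (i < size L)%N by rewrite szL.
have sz1 : size s1 = i by rewrite size_take lti.
have EL : L = s1 ++ y i :: y j :: s2.
  rewrite -{1}(cat_take_drop i L) (drop_nth h0 lti) nth_ord_seq.
  congr (_ ++ _ :: _); by rewrite -ij (drop_nth h0) ?szL // nth_ord_seq.
have EL' : ord_seq (fun k => y (tperm i j k)) = s1 ++ y j :: y i :: s2.
  apply: (eq_from_nth (x0 := h0)) => [|k].
    by rewrite size_ord_seq -szL EL !size_cat.
  rewrite size_ord_seq => ltk; rewrite (nth_ord_seq _ (Ordinal ltk)).
  rewrite (@nth_swap _ h0 s1 s2 (y i) (y j) _ i j (Ordinal ltk)) ?sz1 //.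
  by rewrite -EL nth_ord_seq.
rewrite odd_tperm (_ : i != j); last by rewrite -val_eqE /=; lia.
rewrite !(kmap_at_ce_d_full fc) ?size_ord_seq ?totp // -/L EL' EL.
have := cartanD_alternating gl (kmap_at_alternating fc) (kmap_at_respects fc)
  s1 s2 (y i) (y j).
rewrite -EL => /(negligible_full y1) /eqP.
by rewrite EL addrC addr_eq0 => /eqP.
Qed.

Lemma ce_d_skew n (f : kmap n a M) (s : 'S_n.+2) x : is_cochain f ->
  ce_d br rho f x = (-1) ^+ odd_perm s *:
    dag (fapp (ce_d br rho f) (fun i => var (s i)) [ffun i => x (s i)]).
Proof.
move=> fc; apply: ev_inj => p.
rewrite [RHS]ev_sgn oddb [in RHS]ev_dag [in RHS]ev_fapp.
pose y i : H := (point p i, x i).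
have y1 : (net_momentum (ord_seq y)).2 = 1%N by apply: net_point.
have wy j : weights (ord_seq y) (widen_ord (leqnSn n.+1) j) = (p j)%:P.
  by rewrite /weights nth_ord_seq /= /point widen_lift liftK.
have totp : net_momentum (ord_seq (fun i => y (s i))) = net_momentum (ord_seq y).
  by rewrite !net_ord_seq [RHS](reindex_inj (@perm_inj _ s)).
have E := ce_d_perm s fc y1.
rewrite -kmap_at_point -/(ord_seq y).
have -> : kmap_at (ce_d br rho f) (ord_seq y) =
    neg_if s (kmap_at (ce_d br rho f) (ord_seq (fun i => y (s i)))).
  by rewrite E; case: (odd_perm s); rewrite //= opprK.
congr (neg_if s _); rewrite (kmap_atE _ (size_ord_seq _)).
rewrite (_ : [ffun _ => _] = [ffun i => x (s i)]); last first.
  by apply/ffunP => i; rewrite !ffunE nth_ord_seq.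
apply: eq_ev => j.
rewrite /weights totp (nth_ord_seq _ (widen_ord (leqnSn n.+1) j)).
have le1 : ((net_momentum (ord_seq y)).2 <= 1)%N by rewrite y1.
have [e] := close_weights (s (widen_ord (leqnSn n.+1) j)) (size_ord_seq y) le1.
rewrite /modulus y1 mul0r addr0 /weights nth_ord_seq => <-.
rewrite /close; case: unlift => [k|]; first by rewrite -wy.
by congr (- _ - _); apply: eq_bigr => k _; rewrite -wy.
Qed.

(** Sesquilinearity in the last argument, whose variable is eliminated, follows
    from that in the first one: skew-symmetry exchanges them. *)
Lemma ce_d_cochain n (f : kmap n a M) : is_cochain f -> is_cochain (ce_d br rho f).
Proof.
move=> fc; split.
- by move=> x i; apply: ce_d_linear.
- move=> x i; case: (unliftP ord_max i) => [j ->|->].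
    exact: ce_d_sesquilinear.
  pose s : 'S_n.+2 := tperm ord0 ord_max.
  have odd_s : odd_perm s = true by rewrite odd_tperm.
  have ord0E : ord0 = lift ord_max ord0 :> 'I_n.+2.
    by apply: val_inj; rewrite /= /bump.
  apply: ev_inj => p; set P := fun k => (p k)%:P.
  pose W (l : 'I_n.+1) := close P (s (widen_ord (leqnSn n.+1) l)).
  have skew z : ev P (ce_d br rho f z) =
      - ev W (ce_d br rho f [ffun k => z (s k)]).
    rewrite [in LHS](ce_d_skew s z fc) [LHS]ev_sgn odd_s /=.
    by rewrite [in LHS]ev_dag [in LHS]ev_fapp.
  set x' := fset_at x _ _; pose y := [ffun k => x (s k)].
  have Ey : [ffun k => x' (s k)] = fset_at y ord0 ('X *: y ord0).
    apply/ffunP => k; rewrite !ffunE; rewrite -(inj_eq (@perm_inj _ s) k ord0).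
    by rewrite /s tpermL.
  rewrite [LHS]skew evZ [X in _ = _ *: X]skew Ey.
  have := ce_d_sesquilinear y ord0 fc; rewrite -ord0E => ->.
  rewrite evZ scalerN; congr (- (_ *: _)).
  rewrite !pevalN; congr (- _); rewrite !peval_dagger [X in close W X]ord0E.
  rewrite -widen_lift close_widen /W; congr close.
  rewrite (_ : widen_ord _ _ = ord0); last exact: val_inj.
  by rewrite /s tpermL.
by move=> s x; apply: ce_d_skew.
Qed.

(** Replacing the inner differential by the Cartan one changes the outer one by
    a negligible vector ([cartanD_vanishes]). *)
Lemma ce_d_ce_d n (f : kmap n a M) x : is_cochain f ->
  ce_d br rho (ce_d br rho f) x = 0.
Proof.
move=> fc; apply: ev_inj => p; rewrite raddf0 -kmap_at_point.
set s := ord_seq _; have s1 : (net_momentum s).2 = 1%N by apply: net_point.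
have sz : size s = n.+3 := size_ord_seq _.
rewrite (kmap_at_ce_d_full (ce_d_cochain fc) sz s1).
have E := cartanD_cartanD gl s (kmap_at_respects fc).
have E' := cartanD_vanishes gl (kmap_at_ce_d_cartanD fc) sz.
rewrite (cartanD_sub gl) in E'.
apply: (negligible_full s1); apply: (Zeq _ (ZD gl E' E)); abel.
Qed.

End Differential.

(** * The semi-direct product *)

Section Pairs.
Variable K : fieldType.
Variables (n : nat) (M N : lmodType {poly K}).
Implicit Types (u : vpoly n M) (v : vpoly n N).

Let inl_zmod : zmod_morphism (fun x : M => (x, 0) : M * N).
Proof. by move=> x y; rewrite -[RHS]/(x - y, 0 - 0) subr0. Qed.

Let inr_zmod : zmod_morphism (fun y : N => (0, y) : M * N).
Proof. by move=> x y; rewrite -[RHS]/(0 - 0, x - y) subr0. Qed.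

Lemma mcoeff_vpair u v k : (vpair u v)@_k = (u@_k, v@_k).
Proof.
rewrite /vpair [LHS]mcoeffD [X in X + _](mcoeff_coefmap inl_zmod).
rewrite [X in _ + X](mcoeff_coefmap inr_zmod).
by rewrite -[LHS]/(u@_k + 0, 0 + v@_k) addr0 add0r.
Qed.

Lemma ev_vpair w u v : ev w (vpair u v) = (ev w u, ev w v).
Proof.
rewrite /vpair (zmorphD (ev_zmod w)) [X in X + _](ev_coefmap inl_zmod); last first.
  by move=> c x; rewrite -[RHS]/(c *: x, c *: 0) scaler0.
rewrite [X in _ + X](ev_coefmap inr_zmod); last first.
  by move=> c x; rewrite -[RHS]/(c *: 0, c *: x) scaler0.
by rewrite -[LHS]/(ev w u + 0, 0 + ev w v) addr0 add0r.
Qed.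

Lemma coefmap_fst_vpair u v : coefmap fst (vpair u v) = u.
Proof.
apply/malgP => k; rewrite (mcoeff_coefmap (h := fst)) ?mcoeff_vpair //.
Qed.

Lemma coefmap_snd_vpair u v : coefmap snd (vpair u v) = v.
Proof.
apply/malgP => k; rewrite (mcoeff_coefmap (h := snd)) ?mcoeff_vpair //.
Qed.

Lemma vpair0 : vpair (0 : vpoly n M) (0 : vpoly n N) = 0.
Proof. by apply/malgP => k; rewrite mcoeff_vpair !mcoeff0. Qed.

End Pairs.

Lemma finitely_generated_prod (A : nzRingType) (M N : lmodType A) :
  finitely_generated M -> finitely_generated N ->
  finitely_generated (M * N)%type.
Proof.
move=> [m [g gen_g]] [n [h gen_h]].
exists (m + n)%N, (fun i => match split i with
  | inl j => (g j, 0) | inr j => (0, h j) end) => -[x y].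
have [c ->] := gen_g x; have [d ->] := gen_h y.
exists (fun i => match split i with inl j => c j | inr j => d j end).
rewrite big_split_ord /=.
have sl (i : 'I_m) : split (lshift n i) = inl i := unsplitK (inl i).
have sr (i : 'I_n) : split (rshift m i) = inr i := unsplitK (inr i).
rewrite [X in _ = X + _](eq_bigr (fun i => c i *: ((g i, 0) : M * N)));
  last by move=> i _; rewrite sl.
rewrite [X in _ = _ + X](eq_bigr (fun i => d i *: ((0, h i) : M * N)));
  last by move=> i _; rewrite sr.
have -> : \sum_(i < m) c i *: ((g i, 0) : M * N) = (\sum_i c i *: g i, 0).
  elim/big_rec2: _ => // i z1 z2 _ ->.
  by rewrite -[LHS]/(c i *: g i + z1, c i *: 0 + 0) scaler0 addr0.
have -> : \sum_(i < n) d i *: ((0, h i) : M * N) = (0, \sum_i d i *: h i).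
  elim/big_rec2: _ => // i z1 z2 _ ->.
  by rewrite -[LHS]/(d i *: 0 + 0, d i *: h i + z1) scaler0 addr0.
by rewrite -[RHS]/(_ + 0, 0 + _) addr0 add0r.
Qed.

Section PairOperations.
Variables (A : nzRingType) (M N : lmodType A).

Lemma pairD (x x' : M) (y y' : N) : (x, y) + (x', y') = (x + x', y + y').
Proof. by []. Qed.

Lemma pairN (x : M) (y : N) : - (x, y) = (- x, - y).
Proof. by []. Qed.

Lemma pairB (x x' : M) (y y' : N) : (x, y) - (x', y') = (x - x', y - y').
Proof. by []. Qed.

Lemma pairZ c (x : M) (y : N) : c *: (x, y) = (c *: x, c *: y).
Proof. by []. Qed.

End PairOperations.

Section Semidirect.
Variable K : numFieldType.
Variables (a M : lmodType {poly K}) (br : a -> a -> vpoly 1 a).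
Variable rho : a -> M -> vpoly 1 M.
Hypothesis lca_a : is_lca br.
Hypothesis mod_M : is_lca_module br rho.
Let mod_a := adjoint_module lca_a.
Let E : lmodType {poly K} := (a * M)%type.
Local Notation brE := (semidirect br rho).
Implicit Types (x y z : E).

Lemma ev_inj1 (N : lmodType {poly K}) (u v : vpoly 1 N) :
  (forall c : K, ev (fun=> c%:P) u = ev (fun=> c%:P) v) -> u = v.
Proof.
move=> uv; apply: ev_inj => p.
by rewrite !(eq_ev (w' := fun=> (p ord0)%:P)) // => i; rewrite (ord1 i).
Qed.

Lemma act_at_semidirect w x y : act_at brE w x y =
  (act_at br w x.1 y.1, act_at rho w x.1 y.2 - act_at rho (- w - 'X) y.1 x.2).
Proof.
rewrite /act_at /semidirect ev_vpair (ev_zmod _) ev_subst.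
congr (_, _ - _); apply: eq_ev => i; exact: peval_NvarBdpar.
Qed.

Lemma act_semidirect_zmodl w y : zmod_morphism (fun x => act_at brE w x y).
Proof.
move=> x x'; rewrite !act_at_semidirect (act_at_zmodl mod_a).
rewrite (act_at_zmodl mod_M) (act_at_zmodr mod_M).
by rewrite [RHS]pairB; congr (_, _); abel.
Qed.

Lemma act_semidirect_zmodr w x : zmod_morphism (act_at brE w x).
Proof.
move=> y y'; rewrite !act_at_semidirect (act_at_zmodr mod_a).
rewrite (act_at_zmodl mod_M) (act_at_zmodr mod_M).
by rewrite [RHS]pairB; congr (_, _); abel.
Qed.

Lemma act_semidirectZl w q x y :
  act_at brE w (q *: x) y = (q \Po (- w)) *: act_at brE w x y.
Proof.
rewrite !act_at_semidirect (act_atZl mod_a) (act_atZl mod_M).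
rewrite (act_atZr mod_M) (_ : 'X + (- w - 'X) = - w); last by ring.
by rewrite [RHS]pairZ scalerBr.
Qed.

Lemma act_semidirectZr w q x y :
  act_at brE w x (q *: y) = (q \Po ('X + w)) *: act_at brE w x y.
Proof.
rewrite !act_at_semidirect (act_atZr mod_a) (act_atZr mod_M).
rewrite (act_atZl mod_M) (_ : - (- w - 'X) = 'X + w); last by ring.
by rewrite [RHS]pairZ scalerBr.
Qed.

Lemma act_semidirect_skew w x y :
  act_at brE w x y = - act_at brE (- w - 'X) y x.
Proof.
rewrite !act_at_semidirect (act_at_skew lca_a).
rewrite (_ : - (- w - 'X) - 'X = w); last by ring.
by rewrite [RHS]pairN opprB.
Qed.

(** The M-component is a sum of three parts, in which z, y or x contributes its
    component in M, and each part is one commutator identity: for z it is the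
    module axiom at (p, q); in the other parts z acts, with the variable
    n = - (p + q) - ∂. *)
Lemma act_semidirect_jacobi (p q : K) x y z :
  act_at brE p%:P x (act_at brE q%:P y z) =
  act_at brE (p%:P + q%:P) (act_at brE p%:P x y) z
    + act_at brE q%:P y (act_at brE p%:P x z).
Proof.
set l := p%:P; set m := q%:P.
have C (c : K) r : c%:P \Po r = c%:P by exact: comp_polyC.
rewrite !act_at_semidirect /=.
have J := act_at_comm mod_a (lam := l) (mu := m) (nx := l) (ny := m) (nxy := l)
  x.1 y.1 z.1 (C _ _) (C _ _) (C _ _).
have Ez := act_at_comm mod_M (lam := l) (mu := m) (nx := l) (ny := m) (nxy := l)
  x.1 y.1 z.2 (C _ _) (C _ _) (C _ _).
have X (c : K) (r : {poly K}) : (- c%:P - 'X) \Po r = - c%:P - r.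
  by rewrite comp_polyB comp_polyX raddfN /= comp_polyC.
pose n := - (l + m) - 'X.
have Ey := act_at_comm mod_M (lam := l) (mu := n) (nx := l)
  (ny := - m - 'X) (nxy := l) x.1 z.1 y.2 _ (C _ _) (C _ _).
have Ex := act_at_comm mod_M (lam := m) (mu := n) (nx := m)
  (ny := - l - 'X) (nxy := m) y.1 z.1 x.2 _ (C _ _) (C _ _).
have e1 : l + n = - m - 'X by rewrite /n; ring.
have e2 : m + n = - l - 'X by rewrite /n; ring.
have {}Ey := Ey (etrans (X q _) _); have {}Ex := Ex (etrans (X p _) _).
rewrite e1 in Ey; rewrite e2 in Ex.
(* Skew-symmetry yields the inner variable - l - ∂ instead of m; the two are
   congruent modulo ∂ + l + m, which rho(z)_n annihilates. *)
have Ed : act_at rho n z.1 (act_at rho (- l - 'X) y.1 x.2) =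
    act_at rho n z.1 (act_at rho m y.1 x.2).
  apply: subr0_eq; rewrite -(act_at_zmodr mod_M).
  have [v Ev] : exists v, act_at rho (- l - 'X) y.1 x.2 - act_at rho m y.1 x.2
      = (l + m + 'X) *: v.
    by apply: ev_congr => _; exists (-1); ring.
  rewrite Ev (act_atZr mod_M) !comp_polyD !C comp_polyX.
  by rewrite (_ : _ + _ = 0) ?scale0r // /n; ring.
rewrite pairD; congr (_, _); first by rewrite -J subrK.
rewrite !(act_at_zmodr mod_M) -/n Ed.
rewrite -Ez -Ey; last by rewrite /n; ring.
rewrite -Ex; last by rewrite /n; ring.
abel.
Qed.

Lemma semidirect_linl y : klinear (brE^~ y).
Proof.
move=> c x x'; apply: ev_inj1 => w.
rewrite [RHS](zmorphD (ev_zmod _)) [X in _ = X + _]evZ peval_malgC.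
have := zmorphD (act_semidirect_zmodl w%:P y) (c%:P *: x) x'.
by rewrite act_semidirectZl comp_polyC.
Qed.

Lemma semidirect_linr x : klinear (brE x).
Proof.
move=> c y y'; apply: ev_inj1 => w.
rewrite [RHS](zmorphD (ev_zmod _)) [X in _ = X + _]evZ peval_malgC.
have := zmorphD (act_semidirect_zmodr w%:P x) (c%:P *: y) y'.
by rewrite act_semidirectZr comp_polyC.
Qed.

Lemma semidirect_lca : is_lca brE.
Proof.
split.
- exact: finitely_generated_prod (lca_fg lca_a) (lcm_fg mod_M).
- exact: semidirect_linl.
- exact: semidirect_linr.
- move=> x y; apply: ev_inj1 => w; rewrite [RHS]evZ peval_Nvar.
  by have := act_semidirectZl w%:P 'X x y; rewrite comp_polyX.
- move=> x y; apply: ev_inj1 => w; rewrite [RHS]evZ peval_dparDvar.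
  by have := act_semidirectZr w%:P 'X x y; rewrite comp_polyX.
- move=> x y; apply: ev_inj1 => w; rewrite [RHS](zmorphN (ev_zmod _)) ev_subst.
  rewrite [in RHS](eq_ev (w' := fun=> - w%:P - 'X)); last first.
    by move=> i; apply: peval_NvarBdpar.
  exact: act_semidirect_skew.
move=> x y z lam mu; apply: ev_inj => p.
pose P := fun i => (p i)%:P.
have Rl u v : ev P (subst (fun=> lam) (brE u v)) = act_at brE (p 0)%:P u v.
  by rewrite ev_subst; apply: eq_ev => i; rewrite peval_var.
have Rm u v : ev P (subst (fun=> mu) (brE u v)) = act_at brE (p 1)%:P u v.
  by rewrite ev_subst; apply: eq_ev => i; rewrite peval_var.
have Rlm u v : ev P (subst (fun=> lam + mu) (brE u v))
    = act_at brE ((p 0)%:P + (p 1)%:P) u v.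
  by rewrite ev_subst; apply: eq_ev => i; rewrite peval_varDvar.
have E1 : ev P (ext (fun w => subst (fun=> lam) (brE x w))
    (subst (fun=> mu) (brE y z)))
    = act_at brE (p 0)%:P x (act_at brE (p 1)%:P y z).
  refine (etrans (@ev_ext1 K 2 E E (fun w => subst (fun=> lam) (brE x w))
    1 P (p 1)%:P (brE y z) _ _) (Rl _ _)) => [u v|v].
    by rewrite (klinear_zmod (semidirect_linr x)) subst_zmod.
  by rewrite [LHS]Rl [in RHS]Rl [LHS]act_semidirectZr comp_polyC.
have E2 : ev P (ext (fun w => subst (fun=> lam + mu) (brE w z))
    (subst (fun=> lam) (brE x y)))
    = act_at brE ((p 0)%:P + (p 1)%:P) (act_at brE (p 0)%:P x y) z.
  refine (etrans (@ev_ext1 K 2 E E (fun w => subst (fun=> lam + mu) (brE w z))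
    0 P (p 0)%:P (brE x y) _ _) (Rlm _ _)) => [u v|v].
    by rewrite (klinear_zmod (semidirect_linl z)) subst_zmod.
  by rewrite [LHS]Rlm [in RHS]Rlm [LHS]act_semidirectZl comp_polyC.
have E3 : ev P (ext (fun w => subst (fun=> mu) (brE y w))
    (subst (fun=> lam) (brE x z)))
    = act_at brE (p 1)%:P y (act_at brE (p 0)%:P x z).
  refine (etrans (@ev_ext1 K 2 E E (fun w => subst (fun=> mu) (brE y w))
    0 P (p 0)%:P (brE x z) _ _) (Rm _ _)) => [u v|v].
    by rewrite (klinear_zmod (semidirect_linr y)) subst_zmod.
  by rewrite [LHS]Rm [in RHS]Rm [LHS]act_semidirectZr comp_polyC.
refine (etrans E1 (etrans (act_semidirect_jacobi _ _ _ _ _) _)).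
exact (esym (etrans (zmorphD (ev_zmod _) _ _) (congr2 +%R E2 E3))).
Qed.

Lemma semidirect_br_a (x y : a) : br_a brE x y = br x y.
Proof. exact: coefmap_fst_vpair. Qed.

Lemma br_0l (x : a) : br 0 x = 0.
Proof. exact: zmorph0 (klinear_zmod (lca_linl lca_a x)). Qed.

Lemma rho_0r (x : a) : rho x 0 = 0.
Proof. exact: zmorph0 (klinear_zmod (lcm_linr mod_M x)). Qed.

Lemma rho_0l m : rho 0 m = 0.
Proof. exact: zmorph0 (klinear_zmod (lcm_linl mod_M m)). Qed.

Lemma semidirect_rho_a (x : a) m : rho_a brE x m = rho x m.
Proof.
rewrite /rho_a [coefmap _ _]coefmap_snd_vpair /= rho_0l.
by rewrite (zmorph0 (subst_zmod _)) subr0.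
Qed.

Lemma semidirect_br_b u v : br_b brE u v = 0.
Proof.
rewrite /br_b [coefmap _ _]coefmap_snd_vpair /= !rho_0l.
by rewrite (zmorph0 (subst_zmod _)) subr0.
Qed.

Lemma semidirect_rho_b u (x : a) : rho_b brE u x = 0.
Proof. by rewrite /rho_b [coefmap _ _]coefmap_fst_vpair /= br_0l. Qed.

Lemma semidirect_psi1 (x y : a) : psi1 brE x y = 0.
Proof.
rewrite /psi1 [coefmap _ _]coefmap_snd_vpair /= !rho_0r.
by rewrite (zmorph0 (subst_zmod _)) subr0.
Qed.

Lemma semidirect_quasi_twilled : quasi_twilled brE.
Proof.
split; first exact: semidirect_lca.
split.
  split=> [|c x y]; rewrite !inE //= => /eqP-> /eqP->.
  by rewrite scaler0 addr0.
move=> x y; rewrite !inE => /eqP x0 /eqP y0 k.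
by rewrite inE mcoeff_vpair /= x0 y0 br_0l mcoeff0 eqxx.
Qed.

(** The coefficient of degree k of {(x, D x)_lambda (y, D y)} is the pair of the
    coefficients of {x_lambda y} and of rho(x) D y - rho(y) D x; lying in the
    graph of D is the k-th coefficient of the derivation identity. *)
Lemma right_deformation_derivation (D : {linear a -> M}) :
  right_deformation_map brE D <-> is_derivation br rho D.
Proof.
have DB : zmod_morphism D by move=> u v; rewrite linearB.
split=> [[_ subD] x y|derD].
  apply/malgP => k; rewrite (mcoeff_coefmap DB).
  have := subD (x, D x) (y, D y); rewrite !inE !eqxx => /(_ isT isT k).
  by rewrite inE mcoeff_vpair /= => /eqP.
split.
  split=> [|c [x m] [y m']]; rewrite !inE /= ?linear0 //.
  by move=> /eqP-> /eqP->; rewrite linearP.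
move=> [x m] [y m']; rewrite !inE /= => /eqP-> /eqP-> k.
by rewrite inE mcoeff_vpair /= -derD (mcoeff_coefmap DB).
Qed.

End Semidirect.

(** * Unshuffles *)

Lemma increasing_perm1 m (t : 'S_m) :
  (forall i j : 'I_m, (i < j)%N -> (t i < t j)%N) -> t = 1%g.
Proof.
move=> incr.
have ge (i : 'I_m) : (i <= t i)%N.
  case: i => i lti /=; elim: i lti => // i IH lti.
  have lti' : (i < m)%N by apply: ltnW.
  apply: leq_ltn_trans (IH lti') _; exact: incr.
have le d : forall i : 'I_m, (i + d.+1 = m)%N -> (t i <= i)%N.
  elim: d => [|d IH] i id; first by have := ltn_ord (t i); lia.
  have lti : (i.+1 < m)%N by lia.
  have := IH (Ordinal lti) _; have := incr i (Ordinal lti) (ltnSn i).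
  by move=> /= lt le; have := le ltac:(lia); lia.
apply/permP => i; rewrite perm1; apply/val_inj/eqP; rewrite eqn_leq ge andbT.
by apply: (le (m - i).-1); have := ltn_ord i; lia.
Qed.

(** A permutation is determined by its value at a and by the permutation that it
    induces between the complements of a and of this value. *)
Lemma lift_permE m (a : 'I_m.+1) (s : 'S_m.+1) :
  exists t, s = lift_perm a (s a) t.
Proof.
have ne k : s a != s (lift a k).
  by rewrite (inj_eq perm_inj) neq_lift.
pose g k := odflt k (unlift (s a) (s (lift a k))).
have gE k : lift (s a) (g k) = s (lift a k).
  rewrite /g; have [j -> //|/eqP] := unliftP (s a) (s (lift a k)).
  by rewrite eq_sym (negPf (ne k)).
have gI : injective g.
  by move=> k l gkl; apply/(@lift_inj _ a)/(@perm_inj _ s); rewrite -!gE gkl.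
exists (perm gI); apply/permP => k.
by have [j ->|->] := unliftP a k; rewrite ?lift_perm_id // lift_perm_lift permE gE.
Qed.

Lemma lift_ltn m (i : 'I_m.+1) (j k : 'I_m) :
  (lift i j < lift i k)%N = (j < k)%N.
Proof. by rewrite /= /bump; lia. Qed.

(** An unshuffle that leaves one index out is increasing on the others. *)
Lemma unshuffle_last m (s : 'S_m.+1) :
  unshuffle m s = (s == lift_perm ord_max (s ord_max) 1%g).
Proof.
apply/forallP/eqP => [un|->].
  have [t E] := lift_permE ord_max s; rewrite {1}E; congr lift_perm.
  apply: increasing_perm1 => i j lt.
  have := un (lift ord_max i) => /forallP/(_ (lift ord_max j)).
  rewrite !lift_max lt ltn_ord /=.
  by rewrite {1 2}E !lift_perm_lift lift_ltn.
move=> i; apply/forallP => j; apply/implyP => /andP[].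
have [i' ->|->] := unliftP ord_max i; last first.
  by move=> /= lt; exfalso; have := ltn_ord j; lia.
have [j' ->|->] := unliftP ord_max j; last first.
  by move=> _; rewrite lift_max /= ltnn /= leqNgt ltn_ord.
by rewrite !lift_max !lift_perm_lift !perm1 lift_ltn.
Qed.

(** The permutation with values i, j, followed by the other indices in increasing
    order; the value 1 for i = j is a default. *)
Definition pair_perm m (ij : 'I_m.+2 * 'I_m.+2) : 'S_m.+2 :=
  if unlift ij.1 ij.2 is Some j' then
    lift_perm ord0 ij.1 (lift_perm ord0 j' 1%g)
  else 1%g.

Lemma pair_perm0 m (i j : 'I_m.+2) : (i < j)%N -> pair_perm (i, j) ord0 = i.
Proof.
move=> lt; rewrite /pair_perm /=.
by have [j' _|E] := unliftP i j; [rewrite lift_perm_id|rewrite E ltnn in lt].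
Qed.

Lemma lift00 m : lift ord0 ord0 = 1 :> 'I_m.+2.
Proof. exact: val_inj. Qed.

Lemma pair_perm1 m (i j : 'I_m.+2) : (i < j)%N -> pair_perm (i, j) 1 = j.
Proof.
move=> lt; rewrite /pair_perm /=.
have [j' ->|E] := unliftP i j; last by rewrite E ltnn in lt.
by rewrite -lift00 lift_perm_lift lift_perm_id.
Qed.

Lemma pair_permS m (i j : 'I_m.+2) (k : 'I_m) : (i < j)%N ->
  pair_perm (i, j) (lift ord0 (lift ord0 k)) = bump j (bump i k) :> nat.
Proof.
move=> lt; rewrite /pair_perm /=.
have [j' Ej|E] := unliftP i j; last by rewrite E ltnn in lt.
rewrite !lift_perm_lift perm1 Ej /=; move: lt; rewrite Ej /= /bump; lia.
Qed.

Lemma odd_pair_perm m (i j : 'I_m.+2) : (i < j)%N ->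
  odd_perm (pair_perm (i, j)) = ~~ odd (i + j).
Proof.
move=> lt; rewrite /pair_perm /=.
have [j' Ej|E] := unliftP i j; last by rewrite E ltnn in lt.
rewrite !odd_lift_perm odd_perm1 /= addbF.
have -> : (j : nat) = j'.+1 by move: lt; rewrite Ej /= /bump; lia.
by rewrite addnS /= oddD negbK.
Qed.

Lemma lift0_2 m (k : 'I_m.+2) :
  (2 <= k)%N -> exists k' : 'I_m, k = lift ord0 (lift ord0 k').
Proof.
move=> k2; have ltk : (k - 2 < m)%N by have := ltn_ord k; lia.
by exists (Ordinal ltk); apply: val_inj; rewrite /= /bump; lia.
Qed.

Lemma unshuffle_pair m (i j : 'I_m.+2) :
  (i < j)%N -> unshuffle 2 (pair_perm (i, j)).
Proof.
move=> lt; apply/forallP => k; apply/forallP => l.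
apply/implyP => /andP[kl /orP[l2|k2]].
  have -> : k = ord0 by apply: val_inj => /=; lia.
  have -> : l = 1 by rewrite -lift00; apply: val_inj; rewrite /= /bump; lia.
  by rewrite pair_perm0 // pair_perm1.
have [k' Ek] := lift0_2 k2; have [l' El] := lift0_2 (leq_trans k2 (ltnW kl)).
by move: kl; rewrite Ek El !pair_permS // !lift_ltn /bump; lia.
Qed.

Lemma unshuffle_lt01 m (s : 'S_m.+2) : unshuffle 2 s -> (s ord0 < s 1%R)%N.
Proof.
rewrite -lift00 => /forallP/(_ ord0)/forallP/(_ (lift ord0 ord0))/implyP.
by apply.
Qed.

Lemma unshuffle2E m (s : 'S_m.+2) : unshuffle 2 s -> pair_perm (s ord0, s 1) = s.
Proof.
move=> un; have [t Es] := lift_permE ord0 s; have [t' Et] := lift_permE ord0 t.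
have SE k : s (lift ord0 (lift ord0 k)) = lift (s ord0) (lift (t ord0) (t' k)).
  by rewrite {1}Es lift_perm_lift {1}Et lift_perm_lift.
have t'1 : t' = 1%g.
  apply: increasing_perm1 => i j lt.
  have /forallP/(_ (lift ord0 (lift ord0 i))) := un.
  move=> /forallP/(_ (lift ord0 (lift ord0 j))).
  by rewrite !SE !lift_ltn lt orbT.
have s1 : s 1 = lift (s ord0) (t ord0).
  by rewrite -lift00 {1}Es lift_perm_lift.
by rewrite /pair_perm /= s1 liftK -t'1 -Et -Es.
Qed.

Lemma sum_unshuffle_last (V : zmodType) m (F : 'S_m.+1 -> V) :
  \sum_(s : 'S_m.+1 | unshuffle m s) F s =
  \sum_(i < m.+1) F (lift_perm ord_max i 1%g).
Proof.
rewrite (reindex_onto (fun i => lift_perm ord_max i 1%g) (fun s => s ord_max)).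
  by apply: eq_bigl => i; rewrite unshuffle_last lift_perm_id !eqxx.
by move=> s; rewrite unshuffle_last => /eqP.
Qed.

Lemma sum_unshuffle_pair (V : zmodType) m (F : 'S_m.+2 -> V) :
  \sum_(s : 'S_m.+2 | unshuffle 2 s) F s =
  \sum_(i < m.+2) \sum_(j < m.+2 | (i < j)%N) F (pair_perm (i, j)).
Proof.
rewrite pair_big_dep /=.
rewrite (reindex_onto (@pair_perm m) (fun s => (s ord0, s 1))) => [|s]; last first.
  exact: unshuffle2E.
apply: eq_big => [[i j]|[i j] _] //=.
apply/andP/idP => [[/unshuffle_lt01 + /eqP[E1 E2]]|lt]; first by rewrite E1 E2.
by rewrite unshuffle_pair // pair_perm0 // pair_perm1.
Qed.

(** * The differential as a Nijenhuis-Richardson bracket *)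

Section ExtensionMaps.
Variable K : fieldType.

Lemma ext_coefmap n (M N Q : lmodType {poly K}) (g : M -> N)
    (h : N -> vpoly n Q) (u : vpoly n M) :
    zmod_morphism g -> zmod_morphism h ->
  ext h (coefmap g u) = ext (fun m => h (g m)) u.
Proof.
move=> gB hB.
have hgB : zmod_morphism (fun m => h (g m)) by move=> x y; rewrite gB hB.
apply: (malg_ext (f := fun u : vpoly n M => ext h (coefmap g u))
                 (g := ext (fun m => h (g m)))) u => [u v|u v|x k].
- by rewrite (coefmap_zmod gB) (ext_zmod hB).
- exact: (ext_zmod hgB).
by rewrite (coefmapU gB) (extU hB) (extU hgB).
Qed.

(** If h and h' have corresponding values, so have their extensions: both sides
    are additive, and on monomials the two extensions multiply by the same
    polynomial. *)
Lemma ev_ext_map n (M N N' : lmodType {poly K}) (w : 'I_n -> {poly K})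
    (h : M -> vpoly n N) (h' : M -> vpoly n N') (g : {linear N -> N'})
    (u : vpoly n M) :
    zmod_morphism h -> zmod_morphism h' ->
    (forall c, ev w (h' c) = g (ev w (h c))) ->
  ev w (ext h' u) = g (ev w (ext h u)).
Proof.
move=> hB hB' hg.
apply: (malg_ext (f := fun u : vpoly n M => ev w (ext h' u))
                 (g := fun u => g (ev w (ext h u)))) u => [u v|u v|x k].
- by rewrite (ext_zmod hB') ev_zmod.
- by rewrite (ext_zmod hB) ev_zmod linearB.
by rewrite (extU hB) (extU hB') [LHS]evZ [in RHS]evZ hg linearZ.
Qed.

Lemma subst_coefmap m n (M N : lmodType {poly K}) (g : {linear M -> N})
    (q : 'I_m -> {mpoly {poly K}[n]}) (u : vpoly m M) :
  subst q (coefmap g u) = coefmap g (subst q u).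
Proof.
have gB : zmod_morphism g by move=> x y; rewrite linearB.
have gZ (c : {mpoly {poly K}[n]}) (v : vpoly n M) :
    coefmap g (c *: v) = c *: coefmap g v.
  apply: (malg_ext (f := fun v : vpoly n M => coefmap g (c *: v))
                 (g := fun v => c *: coefmap g v)) v => [u1 v|u1 v|x k].
  - by rewrite scalerBr (coefmap_zmod gB).
  - by rewrite (coefmap_zmod gB) scalerBr.
  pose X : vpoly n M := << x *g k >>.
  apply: (malg_ext (f := fun c : {mpoly {poly K}[n]} => coefmap g (c *: X))
                 (g := fun c => c *: coefmap g X)) c => [c d|c d|c l].
  - by rewrite scalerBl (coefmap_zmod gB).
  - by rewrite scalerBl.
  rewrite /X (vscaleU c l x k) [LHS](coefmapU gB) [in RHS](coefmapU gB).
  by rewrite [RHS]vscaleU linearZ.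
apply: (malg_ext (f := fun u : vpoly m M => subst q (coefmap g u))
                 (g := fun u => coefmap g (subst q u))) u => [u v|u v|x k].
- by rewrite (coefmap_zmod gB) subst_zmod.
- by rewrite subst_zmod (coefmap_zmod gB).
rewrite (coefmapU gB) [LHS]substU [in RHS]substU gZ.
by rewrite [in RHS](coefmapU gB).
Qed.

End ExtensionMaps.

Section InjectRight.
Variable K : fieldType.
Variables (M N : lmodType {poly K}).

Definition inject_right (y : N) : M * N := (0, y).

Fact inject_right_linear : linear inject_right.
Proof.
by move=> c x y; rewrite -[RHS]/(c *: 0 + 0, c *: x + y) scaler0 addr0.
Qed.
HB.instance Definition _ :=
  GRing.isLinear.Build {poly K} N (M * N)%type *:%R inject_right
    inject_right_linear.

Lemma inject_right_zmod : zmod_morphism inject_right.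
Proof. by move=> x y; rewrite linearB. Qed.

Lemma vpair0l n (v : vpoly n N) : vpair 0 v = coefmap inject_right v.
Proof.
rewrite /vpair (zmorph0 (coefmap_zmod (h := fun x : M => (x, 0 : N)) _)) ?add0r //.
by move=> x y; rewrite [RHS]pairB subr0.
Qed.

End InjectRight.

Arguments inject_right {K M N} y.

Section DifferentialAsBracket.
Variable K : numFieldType.
Variables (a M : lmodType {poly K}) (br : a -> a -> vpoly 1 a).
Variable rho : a -> M -> vpoly 1 M.
Hypothesis lca_a : is_lca br.
Hypothesis mod_M : is_lca_module br rho.
Let E : lmodType {poly K} := (a * M)%type.
Local Notation brE := (semidirect br rho).
Local Notation P n := {mpoly {poly K}[n]}.

Lemma nu1_hatE (x : {ffun 'I_2 -> E}) : nu1_hat brE x = brE (x 0) (x 1).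
Proof.
rewrite /nu1_hat; case: (x 0) => y u; case: (x 1) => z v.
by rewrite (semidirect_br_a br rho) !(semidirect_rho_a mod_M).
Qed.

Lemma fapp_hat n q (f : kmap n a M) (w : 'I_n.+1 -> P q) (X : {ffun 'I_n.+1 -> E}) :
  fapp (hat f) w X = coefmap inject_right (fapp f w [ffun i => (X i).1]).
Proof. by rewrite /fapp /hat vpair0l subst_coefmap. Qed.

Lemma close_sum n (w : 'I_n -> {poly K}) : \sum_i close w i = - 'X.
Proof.
rewrite big_ord_recr /= close_max.
rewrite (eq_bigr w) => [|i _]; last exact: close_widen.
by rewrite addrA subrr sub0r.
Qed.

Section Terms.
Variables (n : nat) (f : kmap n a M) (x : {ffun 'I_n.+2 -> E}).
Variable w : 'I_n.+2 -> {poly K}.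
Hypothesis fc : is_cochain f.
Hypothesis sum_w : \sum_i w i = - 'X.

Definition action_term (y : 'I_n.+2 -> a) (i : 'I_n.+2) : M :=
  ev w (ext (fun m => subst (fun=> var i) (rho (y i) m))
    (fapp f (fun t => var (lift i t)) [ffun t => y (lift i t)])).

Definition bracket_term (y : 'I_n.+2 -> a) (i j : 'I_n.+2) : M :=
  ev w (let skip t : 'I_n.+2 := inord (bump j (bump i t)) in
    ext (fun c => fapp f (fcons (var i + var j) (fun t => var (skip t)))
                         [ffun t => fcons c (fun t' => y (skip t')) t])
        (subst (fun=> var i) (br (y i) (y j)))).

(** f takes all the arguments but x_i and is the first argument of nu_1, with the
    sum of their variables, which is - ∂ - w i.  Skew-symmetry of the bracket
    moves x_i to the front: the sign changes, and the variable is w i. *)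
Lemma star_nu1_hat_term (i : 'I_n.+2) :
  let sg k : 'I_n.+2 := lift_perm ord_max i 1%g (inord k) in
  ev w (ext (fun c => fapp (nu1_hat brE)
            (fcons (\sum_(j < n.+1) var (sg j)) (fun t => var (sg (n.+1 + t)%N)))
            [ffun t => fcons c (fun t' => x (sg (n.+1 + t')%N)) t])
         (fapp (hat f) (fun j => var (sg j)) [ffun j : 'I_n.+1 => x (sg j)]))
  = - inject_right (action_term (fun k => (x k).1) i).
Proof.
move=> sg.
have sgl (t : 'I_n.+1) : sg t = lift i t.
  rewrite /sg (_ : inord t = lift ord_max t) ?lift_perm_lift ?perm1 //.
  by apply: ord_inj; rewrite lift_max inordK //; have := ltn_ord t; lia.
have sgi : sg (n.+1 + 0)%N = i.
  rewrite /sg (_ : inord _ = ord_max) ?lift_perm_id //.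
  by apply: val_inj; rewrite /= addn0 inordK.
set h := (X in ext X _).
have hE c : ev w (h c) = act_at brE (- 'X - w i) c (x i).
  rewrite /h /fapp nu1_hatE !ffunE ev_subst /=.
  rewrite [fcons c _ _]/= [fcons c _ 1]/(x (sg _)) sgi; apply: eq_ev => k.
  rewrite /fcons /= (ord1 k) /= peval_sum.
  rewrite -sum_w (bigD1_ord i) //= [RHS]addrC addKr.
  by apply: eq_bigr => t _; rewrite peval_var sgl.
have hB : zmod_morphism h.
  move=> c d; rewrite /h /fapp !nu1_hatE !ffunE /=.
  by rewrite (klinear_zmod (semidirect_linl lca_a mod_M _)) subst_zmod.
rewrite fapp_hat (ext_coefmap _ (@inject_right_zmod K a M) hB).
have -> : [ffun i0 => ([ffun j : 'I_n.+1 => x (sg j)] i0).1] =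
    [ffun t => (x (lift i t)).1].
  by apply/ffunP => t; rewrite !ffunE sgl.
have -> : fapp f (fun j => var (sg j)) [ffun t => (x (lift i t)).1] =
    fapp f (fun t => var (lift i t)) [ffun t => (x (lift i t)).1].
  by apply: eq_subst => t; rewrite sgl.
apply: (ev_ext_map (g := (\- inject_right)%R)).
- by move=> u v; rewrite (klinear_zmod (lcm_linr mod_M _)) subst_zmod.
- by move=> u v; rewrite (inject_right_zmod) hB.
move=> c; rewrite [LHS]hE act_at_semidirect ev_subst /=.
rewrite (zmorph0 (act_at_zmodl (adjoint_module lca_a) _ _)).
rewrite (zmorph0 (act_at_zmodl mod_M _ _)) sub0r.
rewrite (_ : - (- 'X - w i) - 'X = w i); last by ring.
rewrite -[RHS]/(- 0, - _) oppr0; congr (_, - _).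
by apply: eq_ev => k; rewrite peval_var.
Qed.

(** Only the a-component of nu_1 enters f; it carries the variable
    lambda_i + lambda_j. *)
Lemma star_hat_nu1_term (i j : 'I_n.+2) : (i < j)%N ->
  let sg k : 'I_n.+2 := pair_perm (i, j) (inord k) in
  ev w (ext (fun c => fapp (hat f)
            (fcons (\sum_(k < 2) var (sg k)) (fun t => var (sg (2 + t)%N)))
            [ffun t => fcons c (fun t' => x (sg (2 + t')%N)) t])
         (fapp (nu1_hat brE) (fun k => var (sg k)) [ffun k : 'I_2 => x (sg k)]))
  = inject_right (bracket_term (fun k => (x k).1) i j).
Proof.
move=> ltij sg; pose skip t : 'I_n.+2 := inord (bump j (bump i t)).
have sg0 : sg 0%N = i.
  rewrite /sg (_ : inord 0 = ord0) ?pair_perm0 //.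
  by apply: ord_inj; rewrite inordK.
have sg1 : sg 1%N = j.
  rewrite /sg (_ : inord 1 = 1) ?pair_perm1 // -lift00.
  by apply: ord_inj; rewrite inordK.
have sg2 t : (t < n)%N -> sg (2 + t)%N = skip t.
  move=> ltt; apply: ord_inj; rewrite /skip inordK; last by rewrite /bump; lia.
  rewrite -(pair_permS (Ordinal ltt) ltij) /sg.
  rewrite (_ : inord _ = lift ord0 (lift ord0 (Ordinal ltt))) //.
  by apply: ord_inj; rewrite inordK.
pose w1 := fcons (\sum_(k < 2) var (sg k)) (fun t => var (sg (2 + t)%N))
  : 'I_n.+1 -> P n.+2.
pose h1 (c : a) : vpoly n.+2 M :=
  fapp f w1 [ffun t => fcons c (fun t' => (x (sg (2 + t')%N)).1) t].
have h1B : zmod_morphism h1 by exact: (fapp_fcons_zmod w1 _ fc).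
have h1E : (fun c => fapp (hat f) w1
      [ffun t => fcons c (fun t' => x (sg (2 + t')%N)) t]) =
    (fun c => coefmap inject_right (h1 c.1)).
  apply: boolp.funext => c; rewrite fapp_hat /h1; congr (coefmap _ (fapp _ _ _)).
  by apply/ffunP => t; rewrite !ffunE /fcons; case: (val t).
rewrite -/w1 h1E.
have fstB : zmod_morphism (@fst a M) by move=> u v.
have h2B : zmod_morphism (fun y : a => coefmap (inject_right : M -> E) (h1 y)).
  by move=> u v; rewrite h1B (coefmap_zmod (@inject_right_zmod K a M)).
rewrite -(ext_coefmap (g := fst) (h := fun y => coefmap inject_right (h1 y))) //.
rewrite -(@subst_coefmap K _ _ E a fst).
have -> : coefmap fst (nu1_hat brE [ffun k : 'I_2 => x (sg k)]) =
    br (x i).1 (x j).1.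
  by rewrite nu1_hatE [LHS]coefmap_fst_vpair !ffunE sg0 sg1.
have -> : (fun k : 'I_1 => var (sg (widen_ord (leqnSn 1) k)) : P n.+2) =
    (fun=> var i).
  by apply: boolp.funext => k; rewrite (ord1 k) /= sg0.
refine (@ev_ext_map K _ _ _ _ _ _ _ inject_right _ _ h2B _) => [|c].
  exact: (fapp_fcons_zmod _ _ fc).
rewrite [LHS](ev_coefmap (@inject_right_zmod K a M)); last first.
  by move=> q y; rewrite linearZ.
apply: (congr1 inject_right).
rewrite /h1 [LHS]ev_subst [RHS]ev_subst.
have -> : [ffun t : 'I_n.+1 => fcons c (fun t' => (x (sg (2 + t')%N)).1) t] =
    [ffun t : 'I_n.+1 => fcons c (fun t' => (x (skip t')).1) t].
  by apply/ffunP => -[[|t] ltt]; rewrite !ffunE /fcons //= sg2.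
have sum2 : \sum_(k < 2) var (sg k) = var i + var j :> P n.+2.
  rewrite big_ord_recl big_ord1.
  exact (congr2 (fun u v => var u + var v : P n.+2) sg0 sg1).
apply: eq_ev => k; rewrite /w1 /fcons.
case: k => [[|k] ltk]; first exact (congr1 (peval w) sum2).
exact (congr1 (fun s => peval w (var s)) (sg2 k (ltnW ltk))).
Qed.

Lemma ev_ce_sum (y : 'I_n.+2 -> a) (X : {ffun 'I_n.+2 -> a}) :
    (forall i, X i = y i) ->
  ev w (\sum_(i < n.+2) (-1) ^+ i *:
        ext (fun m => subst (fun=> var i) (rho (X i) m))
          (fapp f (fun t => var (lift i t)) [ffun t => X (lift i t)])
      + \sum_(i < n.+2) \sum_(j < n.+2 | (i < j)%N) (-1) ^+ (i + j) *:
        let skip t : 'I_n.+2 := inord (bump j (bump i t)) in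
        ext (fun c => fapp f (fcons (var i + var j) (fun t => var (skip t)))
                        [ffun t => fcons c (fun t' => X (skip t')) t])
          (subst (fun=> var i) (br (X i) (X j)))) =
  \sum_(i < n.+2) neg_if (odd i) (action_term y i) +
  \sum_(i < n.+2) \sum_(j < n.+2 | (i < j)%N)
    neg_if (odd (i + j)) (bracket_term y i j).
Proof.
move=> /boolp.funext<-; rewrite [LHS](zmorphD (ev_zmod w)); congr (_ + _).
  rewrite (zmorph_sum (ev_zmod w)).
  by apply: eq_bigr => i _; rewrite [LHS]ev_sgn.
rewrite (zmorph_sum (ev_zmod w)); apply: eq_bigr => i _.
rewrite (zmorph_sum (ev_zmod w)); apply: eq_bigr => j _.
by rewrite [LHS]ev_sgn.
Qed.

End Terms.

Lemma ev_star_nu1_hat n (f : kmap n a M) (x : {ffun 'I_n.+2 -> E})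
    (w : 'I_n.+1 -> {poly K}) :
  ev w (star (p := n.+1) (nu1_hat brE) (hat f) x) =
  inject_right (neg_if (odd n) (\sum_(i < n.+2)
    neg_if (odd i) (action_term f (close w) (fun k => (x k).1) i))).
Proof.
rewrite /star sum_unshuffle_last (zmorph_sum (ev_zmod w)).
rewrite (zmorph_sum (@neg_if_zmod _ _)) (zmorph_sum (@inject_right_zmod K a M)).
apply: eq_bigr => i _; rewrite [LHS]ev_sgn ev_dag.
rewrite [X in neg_if _ X](star_nu1_hat_term f x (close_sum w) i).
rewrite odd_lift_perm odd_perm1 addbF oddb /=.
have injN := zmorphN (@inject_right_zmod K a M).
by case: (odd n); case: (odd i); rewrite /= ?opprK ?injN ?opprK.
Qed.

Lemma ev_star_hat_nu1 n (f : kmap n a M) (x : {ffun 'I_n.+2 -> E})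
    (w : 'I_n.+1 -> {poly K}) : is_cochain f ->
  ev w (star (p := n.+1) (hat f) (nu1_hat brE) x) =
  - inject_right (\sum_(i < n.+2) \sum_(j < n.+2 | (i < j)%N)
    neg_if (odd (i + j)) (bracket_term f (close w) (fun k => (x k).1) i j)).
Proof.
move=> fc; rewrite /star sum_unshuffle_pair (zmorph_sum (ev_zmod w)).
rewrite (zmorph_sum (@inject_right_zmod K a M)) -sumrN; apply: eq_bigr => i _.
rewrite (zmorph_sum (ev_zmod w)) (zmorph_sum (@inject_right_zmod K a M)) -sumrN.
apply: eq_bigr => j ltij; rewrite [LHS]ev_sgn ev_dag.
rewrite [X in neg_if _ X](star_hat_nu1_term x (close w) fc ltij).
rewrite odd_pair_perm // oddb neg_if_negb.
by case: (odd _); rewrite //= (zmorphN (@inject_right_zmod K a M)).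
Qed.

(** The unshuffle for i has the sign (-1)^(n + 1 + i) and the one for i < j the
    sign (-1)^(i + j + 1); with the sign of [star_nu1_hat_term] and the sign
    - (-1)^n of the bracket, both sums come with (-1)^n times their sign in
    the differential. *)
Lemma nr_bracket_nu1_hat n (f : kmap n a M) (x : {ffun 'I_n.+2 -> E}) :
    is_cochain f ->
  nr_bracket (nu1_hat brE) (hat f) x =
  hat (fun y => (-1) ^+ n *: ce_d br rho f y) x.
Proof.
move=> fc; apply: (@ev_inj K n.+1) => p; set w := fun k => (p k)%:P.
rewrite /nr_bracket [hat _ x]vpair0l.
rewrite [RHS](ev_coefmap (@inject_right_zmod K a M)); last first.
  by move=> q y; rewrite linearZ.
rewrite [LHS]ev_zmod [X in _ - X]ev_sgn mul1n [in RHS]ev_sgn.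
rewrite [X in _ = inject_right (neg_if _ X)]ev_dag.
rewrite [X in _ = inject_right (neg_if _ X)]
  (ev_ce_sum f (close w) (y := fun k => (x k).1)); last first.
  by move=> k; rewrite ffunE.
rewrite [X in X - _]ev_star_nu1_hat [X in _ - neg_if _ X](ev_star_hat_nu1 x w fc).
rewrite (zmorphD (@neg_if_zmod _ _)) (zmorphD (@inject_right_zmod K a M)).
congr (_ + _).
by case: (odd n); rewrite //= ?opprK // (zmorphN (@inject_right_zmod K a M)).
Qed.

End DifferentialAsBracket.

(** * Vanishing brackets and the theorem *)

Section ZeroBrackets.
Variables (K : fieldType) (E : lmodType {poly K}).

Lemma fapp0 n q (w : 'I_n.+1 -> {mpoly {poly K}[q]}) (x : {ffun 'I_n.+1 -> E}) :
  fapp (fun=> 0 : vpoly n E) w x = 0.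
Proof. exact: zmorph0 (subst_zmod _). Qed.

Lemma star0l m n p (g : kmap n E E) (x : {ffun 'I_p.+1 -> E}) :
  star (fun=> 0 : vpoly m E) g x = 0.
Proof.
rewrite /star big1 // => s _.
rewrite (_ : ext _ _ = 0); first by rewrite /dag (zmorph0 (subst_zmod _)) scaler0.
by rewrite /ext big1 // => k _; rewrite fapp0 scaler0.
Qed.

Lemma star0r m n p (f : kmap m E E) (x : {ffun 'I_p.+1 -> E}) :
  star f (fun=> 0 : vpoly n E) x = 0.
Proof.
rewrite /star big1 // => s _.
rewrite (_ : ext _ _ = 0); first by rewrite /dag (zmorph0 (subst_zmod _)) scaler0.
by rewrite fapp0 /ext msupp0 big_seq_fset0.
Qed.

Lemma nr_bracket0l m n (g : kmap n E E) (x : {ffun 'I_(m + n).+1 -> E}) :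
  nr_bracket (fun=> 0 : vpoly m E) g x = 0.
Proof. by rewrite /nr_bracket star0l star0r scaler0 subr0. Qed.

End ZeroBrackets.

Theorem corollary3p23 (R : realType) (a M : lmodType {poly R[i]})
    (br : a -> a -> vpoly 1 a) (rho : a -> M -> vpoly 1 M)
    (lca_a : is_lca br) (mod_M : is_lca_module br rho) :
  let brE := semidirect br rho in
  let d n (f : kmap n a M) : kmap n.+1 a M := ce_d br rho f in
  (quasi_twilled brE /\
   (forall x y, br_a brE x y = br x y) /\
   (forall x m, rho_a brE x m = rho x m) /\
   (forall u v, br_b brE u v = 0) /\
   (forall u x, rho_b brE u x = 0) /\
   (forall x y, psi1 brE x y = 0)) /\
  (forall D : {linear a -> M},
     right_deformation_map brE D <-> is_derivation br rho D) /\
  (forall n (f : cochain n a M), is_cochain (d n f)) /\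
  (forall n (f : cochain n a M) x, d n.+1 (d n f) x = 0) /\
  (forall x, tagged (linf brE [::]) x = 0) /\
  (forall n (f : cochain n a M) x,
     tagged (linf brE [:: Tagged (fun n => cochain n a M) f]) x =
       hat (fun y => (-1) ^+ n *: d n f y) x) /\
  (forall (fs : seq {n : nat & cochain n a M}) x,
     (2 <= size fs)%N -> tagged (linf brE fs) x = 0).
Proof.
move=> brE d.
have nu2 : nu2_hat brE = fun=> 0.
  apply: boolp.funext => x; rewrite /nu2_hat; case: (x 0) => y u.
  case: (x 1) => z v; rewrite (semidirect_br_b mod_M) !(semidirect_rho_b rho lca_a).
  by rewrite (zmorph0 (subst_zmod _)) subr0 vpair0.
split.
  split; first exact: semidirect_quasi_twilled.
  split; first exact: semidirect_br_a.
  split; first exact: (semidirect_rho_a mod_M).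
  split; first exact: (semidirect_br_b mod_M).
  split; first exact: (semidirect_rho_b rho lca_a).
  exact: (semidirect_psi1 mod_M).
split; first exact: right_deformation_derivation.
split; first by move=> n f; apply: (ce_d_cochain lca_a mod_M (cochainP f)).
split; first by move=> n f x; apply: (ce_d_ce_d lca_a mod_M _ (cochainP f)).
split; first by move=> x; rewrite /= /psi_hat (semidirect_psi1 mod_M) vpair0.
split.
  by move=> n f x; apply: (nr_bracket_nu1_hat lca_a mod_M _ (cochainP f)).
case=> [|f [|g [|h fs]]] x //= _.
have nu2f : nr_bracket (nu2_hat brE) (hat (tagged f)) = fun=> 0.
  by apply: boolp.funext => y; rewrite nu2 nr_bracket0l.
by rewrite nu2f nr_bracket0l.
Qed.
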